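(* For any quasi-trigonometric solution $X$ of the classical Yang-Baxter equation there exists an isomorphism of Lie algebras between $D_X(\mathfrak g[u])$ and $\mathfrak g((u^{-1}))\oplus\mathfrak g$ which is identical on $\mathfrak g[u]$ and which transforms the canonical bilinear form on $D_X(\mathfrak g[u])$ to the form $Q$.
   Context: $\mathfrak g$ is a simple complex finite-dimensional Lie algebra, $K$ its Killing form, $\Omega\in\mathfrak g\otimes\mathfrak g$ the quadratic Casimir element with respect to $K$. A quasi-trigonometric solution is a function $X(u,v)=\frac{v\Omega}{u-v}+p(u,v)$, with $p(u,v)$ a polynomial in $u,v$ with coefficients in $\mathfrak g\otimes\mathfrak g$, satisfying the classical Yang-Baxter equation (CYBE), i.e. the two equations $$[X^{12}(u_1,u_2),X^{13}(u_1,u_3)]+[X^{12}(u_1,u_2),X^{23}(u_2,u_3)]+[X^{13}(u_1,u_3),X^{23}(u_2,u_3)]=0,\qquad X^{12}(u,v)=-X^{21}(v,u).$$ Such an $X$ induces a Lie bialgebra structure on $\mathfrak g[u]=\mathfrak g\otimes\mathbb C[u]$ via the 1-cocycle $\delta_X(a(u))=[X(u,v),a(u)\otimes1+1\otimes a(v)]$. For a Lie bialgebra $(\mathfrak a,\delta)$, the classical double $D(\mathfrak a,\delta)$ is the unique Lie algebra structure on the vector space $\mathfrak a\oplus\mathfrak a^*$ which induces the given Lie algebra structures on $\mathfrak a$ and on $\mathfrak a^*$ (the latter being dual to $\delta$) and for which the canonical bilinear form $(x_1+l_1,x_2+l_2)\mapsto l_1(x_2)+l_2(x_1)$ is invariant.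 $D_X(\mathfrak g[u])$ denotes the classical double of $(\mathfrak g[u],\delta_X)$. The direct sum of Lie algebras $\mathfrak g((u^{-1}))\oplus\mathfrak g$, where $\mathfrak g((u^{-1}))=\mathfrak g\otimes\mathbb C((u^{-1}))$, carries the invariant bilinear form $$Q((f(u),a),(g(u),b))=K(f(u),g(u))_0-K(a,b),$$ the index $0$ meaning the free term (coefficient of $u^0$). $\mathfrak g[u]$ is embedded in $\mathfrak g((u^{-1}))\oplus\mathfrak g$ via $a(u)\mapsto(a(u),a(0))$; ''identical on $\mathfrak g[u]$'' means that the isomorphism intertwines this embedding with the canonical embedding $\mathfrak g[u]\subset D_X(\mathfrak g[u])$. *)

(* Defs.v *)
From HB Require Import structures.
From mathcomp Require Import all_boot all_order all_algebra.
From mathcomp Require Import all_classical all_reals.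
From mathcomp Require Import complex zify.

Set Implicit Arguments.
Unset Strict Implicit.
Unset Printing Implicit Defensive.

Import Order.TTheory GRing.Theory Num.Theory.
Local Open Scope ring_scope.
Local Open Scope quotient_scope.

Notation is_bilinear f := (bilinear_for *:%R *:%R f).

Section Tensor.
Context {K : fieldType}.
Implicit Types V W U : lmodType K.

Definition tsum V W U (f : V -> W -> U) (s : seq (V * W)) : U :=
  \sum_(p <- s) f p.1 p.2.

(* The tensor product is the set of finite formal sums of pairs (x, y), two of
   them being identified when all bilinear maps agree on them. *)
Definition tequiv V W (s t : seq (V * W)) : bool :=
  `[< forall U (f : V -> W -> U), is_bilinear f -> tsum f s = tsum f t >].

Lemma tequiv_refl V W : reflexive (@tequiv V W).
Proof. by move=> s; apply/asboolP. Qed.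

Lemma tequiv_sym V W : symmetric (@tequiv V W).
Proof.
by move=> s t; apply/asboolP/asboolP => h U f fl; rewrite h.
Qed.

Lemma tequiv_trans V W : transitive (@tequiv V W).
Proof.
move=> s t r /asboolP h /asboolP h'; apply/asboolP => U f fl.
by rewrite h// h'.
Qed.

Canonical tequiv_equiv V W :=
  EquivRel (@tequiv V W) (@tequiv_refl V W) (@tequiv_sym V W)
    (@tequiv_trans V W).

Definition tensor V W := {eq_quot (@tequiv V W)}.
HB.instance Definition _ V W := Choice.on (tensor V W).
HB.instance Definition _ V W := EqQuotient.on (tensor V W).

(* The linear map on the tensor product induced by f, meaningful only for f
   bilinear: it is computed on a chosen representative. *)
Definition tlift V W U (f : V -> W -> U) (t : tensor V W) : U :=
  tsum f (repr t).

Lemma tlift_pi V W U (f : V -> W -> U) (s : seq (V * W)) :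
  is_bilinear f -> tlift f (\pi_(tensor V W) s) = tsum f s.
Proof.
move=> fl; rewrite /tlift.
have /eqmodP/asboolP h : repr (\pi_(tensor V W) s) = s %[mod tensor V W].
  by rewrite reprK.
exact: h.
Qed.

Lemma tensorP V W (t t' : tensor V W) :
  (forall U (f : V -> W -> U), is_bilinear f -> tlift f t = tlift f t') ->
  t = t'.
Proof.
move=> h; rewrite -[t]reprK -[t']reprK.
by apply/eqmodP/asboolP.
Qed.

Definition tens V W (x : V) (y : W) : tensor V W := \pi_(tensor V W) [:: (x, y)].

Definition tadd V W (s t : tensor V W) : tensor V W :=
  \pi_(tensor V W) (repr s ++ repr t).
Definition tscale V W (c : K) (t : tensor V W) : tensor V W :=
  \pi_(tensor V W) [seq (c *: p.1, p.2) | p <- repr t].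
Definition tzero V W : tensor V W := \pi_(tensor V W) [::].
Definition topp V W (t : tensor V W) := tscale (- 1) t.

Lemma bilinear_lZ V W U (f : V -> W -> U) c x y : is_bilinear f ->
  f (c *: x) y = c *: f x y.
Proof.
move=> [fl _]; have f0 : f 0 y = 0.
  by have /= := fl y (-1) 0 0; rewrite scaler0 addr0 scaleN1r addNr.
by have := fl y c x 0; rewrite /= !addr0 f0 addr0.
Qed.

Lemma tlift_add V W U (f : V -> W -> U) s t : is_bilinear f ->
  tlift f (tadd s t) = tlift f s + tlift f t.
Proof. by move=> fl; rewrite tlift_pi// /tsum big_cat. Qed.

Lemma tlift_zero V W U (f : V -> W -> U) : is_bilinear f ->
  tlift f (tzero V W) = 0.
Proof. by move=> fl; rewrite tlift_pi// /tsum big_nil. Qed.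

Lemma tlift_scale V W U (f : V -> W -> U) c t : is_bilinear f ->
  tlift f (tscale c t) = c *: tlift f t.
Proof.
move=> fl; rewrite tlift_pi// /tlift /tsum big_map scaler_sumr.
by apply: eq_bigr => p _; rewrite bilinear_lZ.
Qed.

Section Lmod.
Context {V W : lmodType K}.
Implicit Types s t r : tensor V W.

Fact taddA : associative (@tadd V W).
Proof. by move=> s t r; apply: tensorP => U f fl; rewrite !tlift_add// addrA. Qed.

Fact taddC : commutative (@tadd V W).
Proof. by move=> s t; apply: tensorP => U f fl; rewrite !tlift_add// addrC. Qed.

Fact tadd0 : left_id (tzero V W) (@tadd V W).
Proof.
by move=> s; apply: tensorP => U f fl; rewrite tlift_add// tlift_zero// add0r.
Qed.

Fact taddN : left_inverse (tzero V W) (@topp V W) (@tadd V W).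
Proof.
move=> s; apply: tensorP => U f fl.
by rewrite tlift_add// tlift_zero// tlift_scale// scaleN1r addNr.
Qed.

HB.instance Definition _ :=
  GRing.isZmodule.Build (tensor V W) taddA taddC tadd0 taddN.

Fact tscaleA a b t : tscale a (tscale b t) = tscale (a * b) t.
Proof. by apply: tensorP => U f fl; rewrite !tlift_scale// scalerA. Qed.

Fact tscale1 : left_id 1 (@tscale V W).
Proof. by move=> t; apply: tensorP => U f fl; rewrite tlift_scale// scale1r. Qed.

Fact tscaleDr : right_distributive (@tscale V W) +%R.
Proof.
move=> a s t; apply: tensorP => U f fl.
by rewrite tlift_scale// !tlift_add// !tlift_scale// scalerDr.
Qed.

Fact tscaleDl t : {morph (@tscale V W)^~ t : a b / a + b}.
Proof.
move=> a b; apply: tensorP => U f fl.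
by rewrite tlift_add// !tlift_scale// scalerDl.
Qed.

HB.instance Definition _ := GRing.Zmodule_isLmodule.Build K (tensor V W)
  tscaleA tscale1 tscaleDr tscaleDl.

Lemma tens_bilinear : is_bilinear (@tens V W).
Proof.
have E U (f : V -> W -> U) x y : is_bilinear f -> tlift f (tens x y) = f x y.
  by move=> fl; rewrite tlift_pi// /tsum big_seq1.
split=> [y a x x'|x a y y']; apply: tensorP => U f fl;
  rewrite tlift_add// tlift_scale// !E//; case: fl => fl fr.
- exact: fl.
- exact: fr.
Qed.

Lemma tlift_tens U (f : V -> W -> U) x y : is_bilinear f ->
  tlift f (tens x y) = f x y.
Proof. by move=> fl; rewrite tlift_pi// /tsum big_seq1. Qed.

Lemma tlift_linear U (f : V -> W -> U) : is_bilinear f -> linear (tlift f).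
Proof. by move=> fl a s t; rewrite tlift_add// tlift_scale. Qed.

End Lmod.
End Tensor.

Record lieBracket (K : fieldType) (V : lmodType K) := LieBracket {
  lie_op :> V -> V -> V;
  lie_bilinear : is_bilinear lie_op;
  lie_alt : forall x, lie_op x x = 0;
  lie_jacobi : forall x y z,
    lie_op x (lie_op y z) + lie_op y (lie_op z x) + lie_op z (lie_op x y) = 0 }.

Section BilinearTheory.
Context {K : fieldType} {V W U : lmodType K} (f : V -> W -> U).
Hypothesis fb : is_bilinear f.

Lemma bilin0l y : f 0 y = 0.
Proof. by have := bilinear_lZ 0 0 y fb; rewrite !scale0r. Qed.

Lemma bilinDl x x' y : f (x + x') y = f x y + f x' y.
Proof. by have /= := fb.1 y 1 x x'; rewrite !scale1r. Qed.

Lemma bilinZl c x y : f (c *: x) y = c *: f x y.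
Proof. exact: bilinear_lZ. Qed.

Lemma bilin0r x : f x 0 = 0.
Proof. by have /= := fb.2 x (-1) 0 0; rewrite scaler0 addr0 scaleN1r addNr. Qed.

Lemma bilinDr x y y' : f x (y + y') = f x y + f x y'.
Proof. by have /= := fb.2 x 1 y y'; rewrite !scale1r. Qed.

Lemma bilinZr c x y : f x (c *: y) = c *: f x y.
Proof. by have /= := fb.2 x c y 0; rewrite !addr0 bilin0r addr0. Qed.

Lemma bilin_suml I (r : seq I) (P : pred I) F y :
  f (\sum_(i <- r | P i) F i) y = \sum_(i <- r | P i) f (F i) y.
Proof.
exact: (big_morph (f^~ y) (fun x x' => bilinDl x x' y) (bilin0l y)).
Qed.

Lemma bilin_sumr I (r : seq I) (P : pred I) F x :
  f x (\sum_(i <- r | P i) F i) = \sum_(i <- r | P i) f x (F i).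
Proof. exact: (big_morph (f x) (bilinDr x) (bilin0r x)). Qed.

End BilinearTheory.

Lemma lie_anti (K : fieldType) (V : lmodType K) (br : lieBracket V) x y :
  br x y = - br y x.
Proof.
have := lie_alt br (x + y); have b := lie_bilinear br.
rewrite (bilinDl b) !(bilinDr b) !lie_alt add0r addr0 => /eqP.
by rewrite addr_eq0 => /eqP.
Qed.

Section Conv.
Context {K : numFieldType} {V : lmodType K} (br : lieBracket V).
Implicit Types f g h : nat -> V.

Definition conv f g : nat -> V :=
  fun k => \sum_(i < k.+1) br (f i) (g (k - i)%N).

Lemma conv_alt f k : conv f f k = 0.
Proof.
have E : conv f f k = - conv f f k.
  rewrite {1}/conv (reindex_inj rev_ord_inj) /= -sumrN.
  apply: eq_bigr => -[i /= ik] _.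
  have ki : (i <= k)%N by rewrite -ltnS.
  by rewrite subSS subKn//; exact: lie_anti.
apply/eqP; have /eqP := E; rewrite -subr_eq0 opprK -mulr2n -scaler_nat.
by rewrite scaler_eq0 pnatr_eq0.
Qed.

Lemma triple_sum k (F : nat -> nat -> nat -> V) :
  \sum_(i < k.+1) \sum_(j < (k - i).+1) F i j (k - i - j)%N =
  \sum_(i < k.+1) \sum_(j < k.+1) \sum_(l < k.+1)
    if (i + j + l == k)%N then F i j l else 0.
Proof.
apply: eq_bigr => -[i /= ik] _.
rewrite (big_ord_widen k.+1 (fun j => F i j (k - i - j)%N)) ?ltnS ?leq_subr//.
rewrite big_mkcond/=; apply: eq_bigr => -[j /= jk] _.
have [jki|jki] := ltnP j (k - i).+1.
  have lk : (k - i - j < k.+1)%N by rewrite ltnS -subnDA leq_subr.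
  have e : (i + j + (k - i - j))%N = k by rewrite -subnDA subnKC// -leq_subRL.
  rewrite (bigD1 (Ordinal lk))//= e eqxx.
  rewrite big1 ?addr0// => -[l /= lk'] /eqP ne; case: eqP => // e'.
  by case: ne; apply: val_inj => /=; rewrite -e' -addnA addKn addKn.
rewrite big1// => -[l /= lk'] _; case: eqP => // e; exfalso.
by move: jki; rewrite -e -addnA addKn ltnNge leq_addr.
Qed.

Lemma conv_jacobi f g h k :
  conv f (conv g h) k + conv g (conv h f) k + conv h (conv f g) k = 0.
Proof.
have b := lie_bilinear br.
have E f' g' h' : conv f' (conv g' h') k =
    \sum_(i < k.+1) \sum_(j < k.+1) \sum_(l < k.+1)
    if (i + j + l == k)%N then br (f' i) (br (g' j) (h' l)) else 0.
  rewrite -(triple_sum k (fun i j l => br (f' i) (br (g' j) (h' l)))).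
  by apply: eq_bigr => i _; rewrite (bilin_sumr b).
rewrite !E.
have -> : \sum_(i < k.+1) \sum_(j < k.+1) \sum_(l < k.+1)
    (if (i + j + l == k)%N then br (g i) (br (h j) (f l)) else 0) =
  \sum_(l < k.+1) \sum_(i < k.+1) \sum_(j < k.+1)
    if (l + i + j == k)%N then br (g i) (br (h j) (f l)) else 0.
  rewrite [RHS]exchange_big/=; apply: eq_bigr => i _.
  rewrite [RHS]exchange_big/=; apply: eq_bigr => j _.
  by apply: eq_bigr => l _; rewrite addnC addnA.
have -> : \sum_(i < k.+1) \sum_(j < k.+1) \sum_(l < k.+1)
    (if (i + j + l == k)%N then br (h i) (br (f j) (g l)) else 0) =
  \sum_(j < k.+1) \sum_(l < k.+1) \sum_(i < k.+1)
    if (j + l + i == k)%N then br (h i) (br (f j) (g l)) else 0.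
  rewrite [LHS]exchange_big/=; apply: eq_bigr => j _.
  rewrite [LHS]exchange_big/=; apply: eq_bigr => l _.
  by apply: eq_bigr => i _; rewrite -addnA addnC.
rewrite -!big_split/= big1// => i _; rewrite -!big_split/= big1// => j _.
rewrite -!big_split/= big1// => l _.
by case: ifP => _; rewrite ?addr0// lie_jacobi.
Qed.

Lemma conv_linl a f f' g k :
  conv (a *: f + f') g k = a *: conv f g k + conv f' g k.
Proof.
have b := lie_bilinear br.
rewrite /conv scaler_sumr -big_split/=; apply: eq_bigr => i _.
by rewrite -(bilinZl b) -(bilinDl b).
Qed.

Lemma conv_linr a f g g' k :
  conv f (a *: g + g') k = a *: conv f g k + conv f g' k.
Proof.
have b := lie_bilinear br.
rewrite /conv scaler_sumr -big_split/=; apply: eq_bigr => i _.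
by rewrite -(bilinZr b) -(bilinDr b).
Qed.

End Conv.

(* V[u] for a vector space V: the coefficient sequences of finite support. *)
Section PolyModule.
Context {K : numFieldType} {V : lmodType K}.

Definition fin_supp : {pred nat -> V} :=
  fun a => `[< exists N, forall k, (N <= k)%N -> a k = 0 >].

Lemma fin_supp_submod : submod_closed fin_supp.
Proof.
split; first by apply/asboolP; exists 0%N.
move=> c a b /asboolP[N aN] /asboolP[M bM]; apply/asboolP.
exists (maxn N M) => k; rewrite geq_max => /andP[kN kM].
by transitivity (c *: a k + b k); rewrite // aN// bM// scaler0 addr0.
Qed.

HB.instance Definition _ := GRing.isSubmodClosed.Build K (nat -> V) fin_supp
  fin_supp_submod.

Record vpoly := VPoly { pcoef :> nat -> V; _ : pcoef \in fin_supp }.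

HB.instance Definition _ := [isSub for pcoef].
HB.instance Definition _ := [Choice of vpoly by <:].
HB.instance Definition _ := [SubChoice_isSubLmodule of vpoly by <:].

Definition peval (a : vpoly) (z : K) : V :=
  \sum_(k \in [set: nat]) z ^+ k *: a k.

End PolyModule.
Arguments vpoly {K} V.

(* V((u^-1)): the families of coefficients indexed by int that vanish in all
   large enough degrees. *)
Section LaurentModule.
Context {K : numFieldType} {V : lmodType K}.

Definition bdd_degree : {pred int -> V} :=
  fun f => `[< exists N : int, forall k, N < k -> f k = 0 >].

Lemma bdd_degree_submod : submod_closed bdd_degree.
Proof.
split; first by apply/asboolP; exists 0.
move=> c a b /asboolP[N aN] /asboolP[M bM]; apply/asboolP.
exists (Num.max N M) => k; rewrite gt_max => /andP[kN kM].
by transitivity (c *: a k + b k); rewrite // aN// bM// scaler0 addr0.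
Qed.

HB.instance Definition _ := GRing.isSubmodClosed.Build K (int -> V) bdd_degree
  bdd_degree_submod.

Record vlaurent := VLaurent { lcoef :> int -> V; _ : lcoef \in bdd_degree }.

HB.instance Definition _ := [isSub for lcoef].
HB.instance Definition _ := [Choice of vlaurent by <:].
HB.instance Definition _ := [SubChoice_isSubLmodule of vlaurent by <:].

Lemma poly_laurent_subproof (a : vpoly V) :
  (fun k : int => if k is Posz n then a n else 0) \in bdd_degree.
Proof.
apply/asboolP; case: a => a /= /asboolP[N aN]; exists N%:Z => -[k|]//.
by rewrite ltz_nat => /ltnW/aN.
Qed.

Definition poly_laurent (a : vpoly V) : vlaurent :=
  VLaurent (poly_laurent_subproof a).

End LaurentModule.
Arguments vlaurent {K} V.

Section PolyLie.
Context {K : numFieldType} {V : lmodType K} (br : lieBracket V).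

Lemma poly_lie_subproof (a b : vpoly V) : conv br a b \in fin_supp.
Proof.
have bb := lie_bilinear br.
apply/asboolP; case: a b => a /= /asboolP[N aN] [b /= /asboolP[M bM]].
exists (N + M)%N => k k_ge; rewrite /conv big1// => -[i /= ik] _.
have [Ni|iN] := leqP N i; first by rewrite aN// (bilin0l bb).
rewrite bM ?(bilin0r bb)//; rewrite leq_subRL ?(ltnW ik)//.
by apply: leq_trans k_ge; rewrite leq_add2r ltnW.
Qed.

Definition poly_lie_op (a b : vpoly V) : vpoly V :=
  VPoly (poly_lie_subproof a b).

Lemma poly_lie_bilinear : is_bilinear poly_lie_op.
Proof.
split=> [b c a a'|a c b b']; apply: val_inj; apply/funext => k /=.
- exact: conv_linl.
- exact: conv_linr.
Qed.

Lemma poly_lie_alt a : poly_lie_op a a = 0.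
Proof. by apply: val_inj; apply/funext => k /=; exact: conv_alt. Qed.

Lemma poly_lie_jacobi a b c :
  poly_lie_op a (poly_lie_op b c) + poly_lie_op b (poly_lie_op c a) +
  poly_lie_op c (poly_lie_op a b) = 0.
Proof. by apply: val_inj; apply/funext => k /=; exact: conv_jacobi. Qed.

Definition poly_lie : lieBracket (vpoly V) :=
  LieBracket poly_lie_bilinear poly_lie_alt poly_lie_jacobi.

End PolyLie.

Section LaurentLie.
Context {K : numFieldType} {V : lmodType K} (br : lieBracket V).

Definition lconv (f g : int -> V) : int -> V :=
  fun k => \sum_(i \in [set: int]) br (f i) (g (k - i)).

Definition bounded_by (N : int) (f : int -> V) := forall k, N < k -> f k = 0.

Lemma vlaurent_bounded (f : vlaurent V) : exists N, bounded_by N f.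
Proof. by case: f => f /= /asboolP. Qed.

Lemma bounded_by_le N M f : N <= M -> bounded_by N f -> bounded_by M f.
Proof. by move=> NM fN k /(le_lt_trans NM); exact: fN. Qed.

Lemma lconv_bounded N M f g : bounded_by N f -> bounded_by M g ->
  bounded_by (N + M) (lconv f g).
Proof.
have b := lie_bilinear br.
move=> fN gM k k_gt; rewrite /lconv fsbig1// => i _.
have [Ni|iN] := ltP N i; first by rewrite fN// (bilin0l b).
by rewrite gM ?(bilin0r b)// ltrBrDl (le_lt_trans _ k_gt)// lerD2r.
Qed.

Lemma lconvE N M f g (c : nat) : bounded_by N f -> bounded_by M g ->
  lconv f g (N + M - c%:Z) =
  conv br (fun a => f (N - a%:Z)) (fun a => g (M - a%:Z)) c.
Proof.
have b := lie_bilinear br.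
move=> fN gM; rewrite /lconv.
rewrite (fsbigE [seq N - a%:Z | a <- iota 0 c.+1])//; first last.
- move=> i _ ir; have [Ni|iN] := ltP N i; first by rewrite fN// (bilin0l b).
  rewrite gM ?(bilin0r b)//.
  have [a ai] : exists a : nat, N - i = a%:Z.
    by exists `|N - i|%N; rewrite gez0_abs// subr_ge0.
  have ic : (c < a)%N.
    rewrite ltnNge; apply: contra ir => ac; apply/mapP; exists a.
      by rewrite mem_iota.
    by rewrite -ai opprB addrC subrK.
  rewrite [X in _ < X](_ : _ = M - c%:Z + a%:Z); last first.
    by rewrite -ai !addrA [N + M]addrC -!addrA; congr (_ + _); rewrite addrCA.
  by rewrite -[X in X < _](subrK c%:Z) ltrD2l ltz_nat.
- by rewrite map_inj_uniq ?iota_uniq// => x y /addrI/oppr_inj[].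
rewrite (eq_bigl xpredT); last by move=> i; rewrite in_setT.
rewrite big_map -[iota 0 _]/(index_iota 0 c.+1) big_mkord.
apply: eq_bigr => -[i /= ic] _.
congr (br _ (g _)); rewrite -subzn; last by rewrite -ltnS.
by rewrite !opprB; lia.
Qed.

Lemma laurent_lie_subproof (f g : vlaurent V) : lconv f g \in bdd_degree.
Proof.
have [N fN] := vlaurent_bounded f; have [M gM] := vlaurent_bounded g.
by apply/asboolP; exists (N + M); exact: lconv_bounded.
Qed.

Definition laurent_lie_op (f g : vlaurent V) : vlaurent V :=
  VLaurent (laurent_lie_subproof f g).

Lemma bounded_eq N (f g : int -> V) : bounded_by N f -> bounded_by N g ->
  (forall c : nat, f (N - c%:Z) = g (N - c%:Z)) -> f = g.
Proof.
move=> fN gN fg; apply/funext => k; have [Nk|kN] := ltP N k.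
  by rewrite fN// gN.
have [c kc] : exists c : nat, N - k = c%:Z.
  by exists `|N - k|%N; rewrite gez0_abs// subr_ge0.
by have := fg c; rewrite -kc opprB addrC subrK.
Qed.

Lemma bounded_lin N a (f f' : int -> V) : bounded_by N f -> bounded_by N f' ->
  bounded_by N (a *: f + f').
Proof.
move=> fN fN' k Nk.
by transitivity (a *: f k + f' k); rewrite // fN// fN'// scaler0 addr0.
Qed.

Lemma bounded_add N (f f' : int -> V) : bounded_by N f -> bounded_by N f' ->
  bounded_by N (f + f').
Proof. move=> fN fN' k Nk.
by transitivity (f k + f' k); rewrite // fN// fN'// addr0. Qed.

Lemma vlaurent_bounded2 (f g : vlaurent V) :
  exists N, bounded_by N f /\ bounded_by N g.
Proof.
have [N fN] := vlaurent_bounded f; have [M gM] := vlaurent_bounded g.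
exists (Num.max N M); split.
- by apply: bounded_by_le fN; rewrite le_max lexx.
- by apply: bounded_by_le gM; rewrite le_max lexx orbT.
Qed.

Lemma laurent_lie_bilinear : is_bilinear laurent_lie_op.
Proof.
split=> [g a f f'|g a f f']; have [N [fN fN']] := vlaurent_bounded2 f f';
  have [M gM] := vlaurent_bounded g; apply: val_inj => /=.
- have h := bounded_lin a fN fN'.
  apply: (@bounded_eq (N + M)); [exact: lconv_bounded| |].
    by apply: bounded_lin; exact: lconv_bounded.
  move=> c; rewrite (lconvE _ h gM).
  rewrite [RHS]/(a *: lconv f g _ + lconv f' g _) !lconvE//.
  exact: conv_linl.
- have h := bounded_lin a fN fN'.
  apply: (@bounded_eq (M + N)); [exact: lconv_bounded| |].
    by apply: bounded_lin; exact: lconv_bounded.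
  move=> c; rewrite (lconvE _ gM h).
  rewrite [RHS]/(a *: lconv g f _ + lconv g f' _) !lconvE//.
  exact: conv_linr.
Qed.

Lemma laurent_lie_alt f : laurent_lie_op f f = 0.
Proof.
have [N fN] := vlaurent_bounded f; apply: val_inj => /=.
apply: (@bounded_eq (N + N)) => //; first exact: lconv_bounded.
by move=> c; rewrite lconvE//; exact: conv_alt.
Qed.

Lemma laurent_lie_jacobi f g h :
  laurent_lie_op f (laurent_lie_op g h) + laurent_lie_op g (laurent_lie_op h f)
  + laurent_lie_op h (laurent_lie_op f g) = 0.
Proof.
have [N0 [f0 g0]] := vlaurent_bounded2 f g; have [M hM] := vlaurent_bounded h.
pose N := Num.max N0 M.
have fN : bounded_by N f by apply: bounded_by_le f0; rewrite le_max lexx.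
have gN : bounded_by N g by apply: bounded_by_le g0; rewrite le_max lexx.
have {}hM : bounded_by N h by apply: bounded_by_le hM; rewrite le_max lexx orbT.
apply: val_inj => /=.
apply: (@bounded_eq (N + (N + N))) => //.
  by do 2?[apply: bounded_add]; do 2 apply: lconv_bounded => //.
move=> c.
rewrite [LHS]/(lconv f (lconv g h) _ + lconv g (lconv h f) _ +
  lconv h (lconv f g) _).
have E f' g' h' : bounded_by N f' -> bounded_by N g' -> bounded_by N h' ->
  lconv f' (lconv g' h') (N + (N + N) - c%:Z) =
  conv br (fun a => f' (N - a%:Z)) (conv br (fun a => g' (N - a%:Z))
     (fun a => h' (N - a%:Z))) c.
  move=> fb gb hb; rewrite lconvE//; last exact: lconv_bounded.
  by congr (conv br _ _ _); apply/funext => d; exact: lconvE.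
by rewrite !E//; exact: conv_jacobi.
Qed.

Definition laurent_lie : lieBracket (vlaurent V) :=
  LieBracket laurent_lie_bilinear laurent_lie_alt laurent_lie_jacobi.

End LaurentLie.

Section DirectSum.
Context {K : fieldType} {V W : lmodType K}.
Context (brV : lieBracket V) (brW : lieBracket W).

Definition dsum_lie_op (s t : V * W) : V * W := (brV s.1 t.1, brW s.2 t.2).

Lemma dsum_lie_bilinear : is_bilinear dsum_lie_op.
Proof.
have bV := lie_bilinear brV; have bW := lie_bilinear brW.
by split=> [t a s s'|t a s s']; rewrite /dsum_lie_op /=;
  rewrite ?(bilinDl bV, bilinDl bW, bilinZl bV, bilinZl bW);
  rewrite ?(bilinDr bV, bilinDr bW, bilinZr bV, bilinZr bW).
Qed.

Lemma dsum_lie_alt s : dsum_lie_op s s = 0.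
Proof. by rewrite /dsum_lie_op !lie_alt. Qed.

Lemma dsum_lie_jacobi s t r :
  dsum_lie_op s (dsum_lie_op t r) + dsum_lie_op t (dsum_lie_op r s) +
  dsum_lie_op r (dsum_lie_op s t) = 0.
Proof.
by congr (_, _); rewrite /= lie_jacobi.
Qed.

Definition dsum_lie : lieBracket (V * W)%type :=
  LieBracket dsum_lie_bilinear dsum_lie_alt dsum_lie_jacobi.

End DirectSum.

Section Dual.
Context {K : fieldType} {V : lmodType K}.

Definition linear_pred : {pred V -> K^o} := fun l => `[< linear l >].

Lemma linear_pred_submod : submod_closed linear_pred.
Proof.
split; first by apply/asboolP => a x y; rewrite [LHS]/0 scaler0 addr0.
move=> c l m /asboolP ll /asboolP ml; apply/asboolP => a x y.
have E z : (c *: l + m) z = c * l z + m z by [].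
rewrite !E ll ml.
transitivity (c * (a * l x + l y) + (a * m x + m y)); first by [].
transitivity (a * (c * l x + m x) + (c * l y + m y)); last by [].
by rewrite !mulrDr !mulrA [c * a]mulrC addrACA.
Qed.

HB.instance Definition _ := GRing.isSubmodClosed.Build K (V -> K^o) linear_pred
  linear_pred_submod.

Record dual := Dual { dual_fun :> V -> K^o; _ : dual_fun \in linear_pred }.

HB.instance Definition _ := [isSub for dual_fun].
HB.instance Definition _ := [Choice of dual by <:].
HB.instance Definition _ := [SubChoice_isSubLmodule of dual by <:].

End Dual.
Arguments dual {K} V.

Section SimpleLie.
Context {K : fieldType} {g : vectType K} (br : lieBracket g).

Definition is_simple : Prop :=
  (exists x y, br x y <> 0) /\
  forall I : {vspace g}, (forall x y, y \in I -> br x y \in I) ->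
    I = 0%VS \/ I = fullv.

Definition killing (x y : g) : K :=
  let e := vbasis {:g} in \tr (passmx.mxof e e (linfun (br x) \o linfun (br y))%VF).

(* Omega = \sum_i e_i (x) f_i for a pair (e, f) of bases dual with respect to
   the Killing form; it does not depend on the choice of the pair. *)
Definition is_casimir (Omega : tensor g g) : Prop :=
  exists e f : (\dim {:g}).-tuple g,
    [/\ basis_of fullv e, basis_of fullv f,
        forall i j, killing (tnth e i) (tnth f j) = (i == j)%:R
      & Omega = \sum_i tens (tnth e i) (tnth f i)].

End SimpleLie.

Section TensorOperations.
Context {K : fieldType} {V : lmodType K}.

Definition tflip (t : tensor V V) : tensor V V := tlift (fun x y => tens y x) t.

Definition tmap (W : lmodType K) (f g : V -> W) (t : tensor V V) : tensor W W :=
  tlift (fun x y => tens (f x) (g y)) t.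

(* (l (x) m)(t) *)
Definition tpair (l m : V -> K) (t : tensor V V) : K :=
  tlift (fun x y => l x * m y : K^o) t.

Context (br : lieBracket V).

(* [t, a (x) 1 + 1 (x) b] *)
Definition tbr (t : tensor V V) (a b : V) : tensor V V :=
  tlift (fun x y => tens (br x a) y + tens x (br y b)) t.

(* [s^12, t^13], [s^12, t^23] and [s^13, t^23] *)
Definition br12_13 (s t : tensor V V) : tensor (tensor V V) V :=
  tlift (fun x y => tlift (fun x' y' => tens (tens (br x x') y) y') t) s.

Definition br12_23 (s t : tensor V V) : tensor (tensor V V) V :=
  tlift (fun x y => tlift (fun x' y' => tens (tens x (br y x')) y') t) s.

Definition br13_23 (s t : tensor V V) : tensor (tensor V V) V :=
  tlift (fun x y => tlift (fun x' y' => tens (tens x x') (br y y')) t) s.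

End TensorOperations.

Section QuasiTrigonometric.
Context {K : numFieldType} {g : vectType K} (br : lieBracket g).

(* p(u, v), for p in W[u][v] *)
Definition peval2 (W : lmodType K) (p : vpoly (vpoly W)) (u v : K) : W :=
  peval (peval p v) u.

(* X(u, v) is only meaningful off the pole u = v. *)
Definition CYBE (X : K -> K -> tensor g g) : Prop :=
  (forall u1 u2 u3, u1 != u2 -> u1 != u3 -> u2 != u3 ->
     br12_13 br (X u1 u2) (X u1 u3) + br12_23 br (X u1 u2) (X u2 u3) +
     br13_23 br (X u1 u3) (X u2 u3) = 0) /\
  (forall u v, u != v -> X u v = - tflip (X v u)).

Definition quasi_trigonometric_solution (X : K -> K -> tensor g g) : Prop :=
  (exists (Omega : tensor g g) (p : vpoly (vpoly (tensor g g))),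
     is_casimir br Omega /\
     forall u v, u != v -> X u v = (v / (u - v)) *: Omega + peval2 p u v) /\
  CYBE X.

(* delta(a) = [X(u, v), a(u) (x) 1 + 1 (x) a(v)], under the identification of
   g[u] (x) g[u] with (g (x) g)[u, v]: an element of g[u] (x) g[u] is determined
   by its images in g (x) g under evaluation at (u, v), for u <> v. *)
Definition is_cobracket_of (X : K -> K -> tensor g g)
    (delta : vpoly g -> tensor (vpoly g) (vpoly g)) : Prop :=
  forall a u v, u != v ->
    tmap (peval^~ u) (peval^~ v) (delta a) =
    tbr br (X u v) (peval a u) (peval a v).

(* K(f(u), h(u))_0 - K(x, y) *)
Definition Qform (s t : vlaurent g * g) : K :=
  \sum_(k \in [set: int]) killing br (s.1 k) (t.1 (- k)) - killing br s.2 t.2.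

Definition poly_embedding (a : vpoly g) : vlaurent g * g :=
  (poly_laurent a, peval a 0).

End QuasiTrigonometric.

Section LieBialgebra.
Context {K : fieldType} {V : lmodType K} (br : lieBracket V).
Context (delta : V -> tensor V V).

Definition is_dual_bracket (B : dual V -> dual V -> dual V) : Prop :=
  forall l m x, B l m x = tpair l m (delta x).

Definition is_lie_bialgebra : Prop :=
  [/\ linear delta,
      forall x y,
        delta (br x y) = tbr br (delta x) y y - tbr br (delta y) x x
    & exists B : lieBracket (dual V), is_dual_bracket B].

Definition double_form (s t : V * dual V) : K := s.2 t.1 + t.2 s.1.

Definition is_classical_double (D : lieBracket (V * dual V)%type) : Prop :=
  [/\ forall x y, D (x, 0) (y, 0) = (br x y, 0),
      exists2 B, is_dual_bracket B & forall l m, D (0, l) (0, m) = (0, B l m)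
    & forall r s t, double_form (D r s) t = double_form r (D s t)].

End LieBialgebra.

(* Main.v *)
Require Import Defs.
From HB Require Import structures.
From mathcomp Require Import all_boot all_order all_algebra.
From mathcomp Require Import all_classical all_reals.
From mathcomp Require Import complex zify ring.

Set Implicit Arguments.
Unset Strict Implicit.
Unset Printing Implicit Defensive.

Import Order.TTheory GRing.Theory Num.Theory.
Local Open Scope ring_scope.

(** Write V = g[u] and L = g((u^-1)) + g, and let X = v Omega / (u - v) + p.  The
idea is to read X as a generating function: expand it for |u| > |v| as the sum
over n of u^n X_n(v), where X_n is the coefficient of u^n in p for n >= 0 and
v^(-n) Omega for n < 0, so that each X_n lies in g (x) V.  A functional l on V
can be applied to the second factor of each X_n, and also to that of X(0, v);
this gives a map psi : V^* -> L.  The classical double is then the Lie algebra L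
itself, seen through phi (a, l) = (a, a(0)) + psi l ([triple_map]).

Why phi does everything that is asked:
- it is an isometry ([Qform_triple]).  The terms v^k u^-k Omega of X are dual to
  the monomials for the Killing form, so that Q (psi l, a) = l(a)
  ([Qform_psi_poly]); g[u] is isotropic; and psi (V^* ) is isotropic because the
  skew-symmetry of X says that p + p^21 = Omega ([phat_skew],
  [Qform_psi_psi]).
- it is bijective.  An element s of L determines the functional l = Q (s, .) on
  V, and s - psi l is orthogonal to g[u]; but g[u] is its own orthogonal
  ([poly_lagrangian]).
- psi is a morphism for the bracket of V^* dual to the cobracket delta
  ([psi_lie]).  Applying l and m to the second and third factors turns
  [X^12, X^13] into [psi l, psi m], while [X^12, X^23] + [X^13, X^23] is, up to
  sign, delta applied to the second factor of X; so the classical Yang-Baxter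
  equation says exactly that [psi l, psi m] = psi ([l, m]).

The equation holds at points off the diagonals, whereas the last item needs it
coefficient by coefficient in u.  [polar_identity] makes this passage without
analysis: multiplying the expansion by (1 - v/u)(1 - w/u) turns it into a
polynomial, and this multiplication is injective on power series in 1/u.
Polynomial identities with coefficients in a vector space follow from their
values by inverting a Vandermonde matrix ([module_poly_eq0]); in particular an
element of V (x) V is determined by its values off the diagonal ([eval2_inj]),
which gives the uniqueness of delta and reduces the cocycle identity to the
Jacobi identity at points.

What is left is formal ([manin_triple_classical_double]): transporting the
bracket of L through phi gives a classical double, the Lie axioms for V^* come
from the injectivity of psi, and a double is determined by its two halves because
the form is invariant ([classical_double_unique]). *)

(** * Linear maps and tensors *)

Section LinearMaps.
Context {K : fieldType}.
Implicit Types U V W Z : lmodType K.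

Lemma lin0 U V (F : U -> V) : linear F -> F 0 = 0.
Proof. by move=> l; have /= := l (-1) 0 0; rewrite scaler0 addr0 scaleN1r addNr. Qed.

Lemma linD U V (F : U -> V) x y : linear F -> F (x + y) = F x + F y.
Proof. by move=> l; have /= := l 1 x y; rewrite !scale1r. Qed.

Lemma linZ U V (F : U -> V) a x : linear F -> F (a *: x) = a *: F x.
Proof. by move=> l; have /= := l a x 0; rewrite !addr0 lin0// addr0. Qed.

Lemma linN U V (F : U -> V) x : linear F -> F (- x) = - F x.
Proof. by move=> l; rewrite -scaleN1r linZ// scaleN1r. Qed.

Lemma linB U V (F : U -> V) x y : linear F -> F (x - y) = F x - F y.
Proof. by move=> l; rewrite linD// linN. Qed.

Lemma lin_sum U V (F : U -> V) I (r : seq I) (P : pred I) E : linear F ->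
  F (\sum_(i <- r | P i) E i) = \sum_(i <- r | P i) F (E i).
Proof.
by move=> l; apply: (big_morph F _ (lin0 l)) => x y; exact: linD.
Qed.

Lemma linear_comp U V W (F : V -> W) (G : U -> V) :
  linear F -> linear G -> linear (fun x => F (G x)).
Proof. by move=> lF lG a x y; rewrite lG lF. Qed.

Lemma linear_add U V (F G : U -> V) :
  linear F -> linear G -> linear (fun x => F x + G x).
Proof. by move=> lF lG a x y; rewrite lG lF scalerDr addrACA. Qed.

Lemma linear_scale U V (F : U -> V) c : linear F -> linear (fun x => c *: F x).
Proof. by move=> lF a x y; rewrite lF scalerDr !scalerA mulrC. Qed.

Lemma linear_opp U V (F : U -> V) : linear F -> linear (fun x => - F x).
Proof. by move=> lF a x y; rewrite lF opprD scalerN. Qed.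

Lemma linear_sum_fun U V I (r : seq I) (F : I -> U -> V) :
  (forall i, linear (F i)) -> linear (fun x => \sum_(i <- r) F i x).
Proof.
move=> lF a x y; rewrite scaler_sumr -big_split/=.
by apply: eq_bigr => i _; rewrite lF.
Qed.

Lemma bilinear_comp U V U' V' W (h : U' -> V' -> W) (F : U -> U') (G : V -> V') :
  is_bilinear h -> linear F -> linear G ->
  is_bilinear (fun x y => h (F x) (G y)).
Proof.
move=> [hl hr] lF lG; split=> [y a x x'|x a y y'] /=; rewrite ?lF ?lG.
- exact: hl.
- exact: hr.
Qed.

Lemma comp_bilinear U V W W' (h : U -> V -> W) (F : W -> W') :
  is_bilinear h -> linear F -> is_bilinear (fun x y => F (h x y)).
Proof.
move=> [hl hr] lF; split=> [y a x x'|x a y y'] /=.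
- by rewrite -lF; congr F; exact: hl.
- by rewrite -lF; congr F; exact: hr.
Qed.

Lemma bilinear_add U V W (h k : U -> V -> W) :
  is_bilinear h -> is_bilinear k -> is_bilinear (fun x y => h x y + k x y).
Proof.
move=> [hl hr] [kl kr]; split=> [y|x].
- exact: linear_add (hl y) (kl y).
- exact: linear_add (hr x) (kr x).
Qed.

Lemma bilinear_flip U V W (h : U -> V -> W) :
  is_bilinear h -> is_bilinear (fun x y => h y x).
Proof. by case=> hl hr; split. Qed.

Lemma bilinear_scale U V (F : U -> K^o) :
  linear F -> is_bilinear (fun x (y : V) => (F x : K) *: y).
Proof.
move=> lF; split=> [y a x x'|x a y y'] /=.
- by rewrite lF scalerDl scalerA.
- by rewrite scalerDr !scalerA mulrC.
Qed.

End LinearMaps.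

Section TensorTheory.
Context {K : fieldType}.
Implicit Types U V W Z : lmodType K.

(** The chosen representative of a tensor is a decomposition into pure tensors;
extensionality on pure tensors below rests on this. *)
Lemma tensor_sum V W (t : tensor V W) : t = \sum_(p <- repr t) tens p.1 p.2.
Proof.
apply: tensorP => U f fl; rewrite (lin_sum _ _ _ (tlift_linear fl)).
by apply: eq_bigr => p _; rewrite tlift_tens.
Qed.

(** Together with [tlift_tens] this replaces the universal property of the tensor
product in all computations. *)
Lemma tensor_ext V W U (F G : tensor V W -> U) : linear F -> linear G ->
  (forall x y, F (tens x y) = G (tens x y)) -> F =1 G.
Proof.
by move=> lF lG FG t; rewrite [t]tensor_sum !lin_sum//; exact: eq_bigr.
Qed.

Lemma tlift_linear_param Z V W U (f : Z -> V -> W -> U) (t : tensor V W) :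
  (forall x y, linear (fun z => f z x y)) -> linear (fun z => tlift (f z) t).
Proof. by move=> lf; apply: linear_sum_fun => p; exact: lf. Qed.

(** Unlike [tmap], it allows the two factors to be different spaces, as in
g (x) g[v]. *)
Definition hmap V W V' W' (F : V -> V') (G : W -> W') (t : tensor V W) :
  tensor V' W' := tlift (fun x y => tens (F x) (G y)) t.

Section Hmap.
Context (V W V' W' : lmodType K) (F : V -> V') (G : W -> W').
Hypothesis (lF : linear F) (lG : linear G).

Lemma hmap_linear : linear (hmap F G).
Proof. by apply: tlift_linear; exact: bilinear_comp tens_bilinear lF lG. Qed.

Lemma hmap_tens x y : hmap F G (tens x y) = tens (F x) (G y).
Proof. by apply: tlift_tens; exact: bilinear_comp tens_bilinear lF lG. Qed.

End Hmap.

Lemma tmap_tens V W (F G : V -> W) x y : linear F -> linear G ->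
  tmap F G (tens x y) = tens (F x) (G y).
Proof. by move=> lF lG; exact: hmap_tens. Qed.

Lemma tmap_linear V W (F G : V -> W) : linear F -> linear G ->
  linear (tmap F G).
Proof. by move=> lF lG; exact: hmap_linear. Qed.

Lemma tflip_linear V : linear (@tflip K V).
Proof. by apply: tlift_linear; exact: bilinear_flip tens_bilinear. Qed.

Lemma tflip_tens V (x y : V) : tflip (tens x y) = tens y x.
Proof. by apply: tlift_tens; exact: bilinear_flip tens_bilinear. Qed.

Lemma tmap_tflip V W (F G : V -> W) t : linear F -> linear G ->
  tmap F G (tflip t) = tflip (tmap G F t).
Proof.
move=> lF lG; move: t; apply: tensor_ext => [||x y].
- by apply: linear_comp; [exact: tmap_linear|exact: tflip_linear].
- by apply: linear_comp; [exact: tflip_linear|exact: tmap_linear].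
- by rewrite tflip_tens !tmap_tens// tflip_tens.
Qed.

Lemma tpair_fun_bilinear V (l m : V -> K^o) : linear l -> linear m ->
  is_bilinear (fun x y => (l x : K) * m y : K^o).
Proof.
move=> ll lm; apply: (@bilinear_comp _ _ _ K^o K^o K^o
  (fun a b => (a : K) * b) l m) => //.
by apply: (@bilinear_scale _ K^o K^o id) => a x y.
Qed.

Lemma tpair_linear V (l m : V -> K^o) : linear l -> linear m ->
  linear (tpair l m : _ -> K^o).
Proof. by move=> ll lm; apply: tlift_linear; exact: tpair_fun_bilinear. Qed.

Lemma tpair_tens V (l m : V -> K^o) x y : linear l -> linear m ->
  tpair l m (tens x y) = l x * m y.
Proof.
move=> ll lm; apply: (@tlift_tens K V V K^o (fun x y => l x * m y)).
exact: tpair_fun_bilinear.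
Qed.

Definition quadrilinear V W V' W' U (h : V -> W -> V' -> W' -> U) :=
  (forall x' y', is_bilinear (fun x y => h x y x' y')) /\
  (forall x y, is_bilinear (h x y)).

(** The brackets [X^12, X^13], [X^12, X^23] and [X^13, X^23] are all of this
form. *)
Definition tlift2 V W V' W' U (h : V -> W -> V' -> W' -> U)
    (s : tensor V W) (t : tensor V' W') : U :=
  tlift (fun x y => tlift (h x y) t) s.

Lemma tlift2_bilinear V W V' W' U (h : V -> W -> V' -> W' -> U) :
  quadrilinear h -> is_bilinear (tlift2 h).
Proof.
move=> [h1 h2]; split=> [t|s].
  apply: tlift_linear; split=> [y|x]; apply: tlift_linear_param => x' y'.
  - exact: (h1 x' y').1.
  - exact: (h1 x' y').2.
by apply: tlift_linear_param => x y; exact: tlift_linear.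
Qed.

Lemma tlift2_tens V W V' W' U (h : V -> W -> V' -> W' -> U) x y x' y' :
  quadrilinear h -> tlift2 h (tens x y) (tens x' y') = h x y x' y'.
Proof.
move=> [h1 h2]; rewrite /tlift2 tlift_tens ?tlift_tens//.
by split=> [z|z]; apply: tlift_linear_param => u v;
  [exact: (h1 u v).1|exact: (h1 u v).2].
Qed.

Lemma bilinear_tensor_ext V W V' W' U (F G : tensor V W -> tensor V' W' -> U) :
  is_bilinear F -> is_bilinear G ->
  (forall x y x' y',
     F (tens x y) (tens x' y') = G (tens x y) (tens x' y')) ->
  forall s t, F s t = G s t.
Proof.
move=> [Fl Fr] [Gl Gr] FG s t; move: s; apply: tensor_ext => // x y.
by move: t; apply: tensor_ext.
Qed.

End TensorTheory.

Section TensorBracket.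
Context {K : fieldType} {V : lmodType K} (br : lieBracket V).

Let bb := lie_bilinear br.
Let tb := @tens_bilinear K V V.

Lemma tbr_fun_bilinear (a b : V) :
  is_bilinear (fun x y => tens (br x a) y + tens x (br y b)).
Proof.
apply: bilinear_add.
- by apply: (bilinear_comp tb (bb.1 a)) => c x y.
- by apply: (bilinear_comp tb _ (bb.1 b)) => c x y.
Qed.

Lemma tbr_linear a b : linear (fun t => tbr br t a b).
Proof. exact: tlift_linear (tbr_fun_bilinear a b). Qed.

Lemma tbr_tens x y a b :
  tbr br (tens x y) a b = tens (br x a) y + tens x (br y b).
Proof. exact: tlift_tens (tbr_fun_bilinear a b). Qed.

(** [t, a (x) 1 + 1 (x) b] is additive in the pair (a, b), not bilinear. *)
Lemma tbr_linear_param t : linear (fun ab : V * V => tbr br t ab.1 ab.2).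
Proof.
apply: tlift_linear_param => x y; apply: linear_add.
- by apply: (linear_comp (tb.1 y)) => c [a b] [a' b'] /=; exact: (bb.2 x).
- by apply: (linear_comp (tb.2 x)) => c [a b] [a' b'] /=; exact: (bb.2 y).
Qed.

Lemma tbrD t a b a' b' :
  tbr br t (a + a') (b + b') = tbr br t a b + tbr br t a' b'.
Proof. exact: (linD (a, b) (a', b') (tbr_linear_param t)). Qed.

Lemma tbrZ t c a b : tbr br t (c *: a) (c *: b) = c *: tbr br t a b.
Proof. exact: (linZ c (a, b) (tbr_linear_param t)). Qed.

(** The Jacobi identity, in the form used for right multiplications. *)
Lemma lie_derivation x a b :
  br x (br a b) = br (br x a) b - br (br x b) a.
Proof.
have := lie_jacobi br x a b.
rewrite (lie_anti br b (br x a)) (lie_anti br b x) -scaleN1r (bilinZr bb) scaleN1r.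
rewrite (lie_anti br a (br x b)) opprK => /eqP.
by rewrite subr_eq0 => /eqP <-; rewrite addrK.
Qed.

(** t |-> [t, a (x) 1 + 1 (x) a'] is an action of the Lie algebra of pairs
(a, a'): the mixed terms [x, a] (x) [y, b'] cancel in the commutator.  Evaluated
at points this is the cocycle property of the cobracket. *)
Lemma tbr_lie t a b a' b' : tbr br t (br a b) (br a' b') =
  tbr br (tbr br t a a') b b' - tbr br (tbr br t b b') a a'.
Proof.
move: t; apply: tensor_ext => [||x y]; first exact: tbr_linear.
  apply: linear_add; last apply: linear_opp.
    by apply: (linear_comp (tbr_linear b b')); exact: tbr_linear.
  by apply: (linear_comp (tbr_linear a a')); exact: tbr_linear.
rewrite !tbr_tens !(linD _ _ (tbr_linear _ _)) !tbr_tens !lie_derivation.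
rewrite -!scaleN1r (bilinDl tb) (bilinDr tb) (bilinZl tb) (bilinZr tb) !scaleN1r.
have cancel_mixed (A1 A2 B C D1 D2 : tensor V V) :
    A1 - A2 + (D1 - D2) = A1 + B + (C + D1) - (A2 + C + (B + D2)).
  rewrite [C + D1]addrC [B + D2]addrC [A1 + B + _]addrACA [A2 + C + _]addrACA.
  by rewrite [C + B]addrC opprD [RHS]addrACA subrr addr0 opprD addrACA.
exact: cancel_mixed.
Qed.

End TensorBracket.

(** * Polynomials with coefficients in a vector space *)

Section ModulePolynomials.
Context {K : numFieldType}.
Implicit Types U V W Z : lmodType K.

Lemma exists_distinct_points (E : seq K) (N : nat) :
  exists u : 'I_N -> K, injective u /\ forall i, u i \notin E.
Proof.
pose s := [seq (k%:R : K) | k <- iota 0 (size E + N)].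
have us : uniq s.
  by rewrite map_inj_uniq ?iota_uniq// => x y /eqP; rewrite eqr_nat => /eqP.
pose r := [seq x <- s | x \notin E].
have Nr : (N <= size r)%N.
  have := count_predC (mem E) s; rewrite [size s]size_map size_iota.
  rewrite /r size_filter => e.
  have : (count (mem E) s <= size E)%N.
    rewrite -size_filter; apply: uniq_leq_size; first exact: filter_uniq.
    by move=> x; rewrite mem_filter => /andP[].
  have -> : count (fun x => x \notin E) s = count (predC (mem E)) s by [].
  by lia.
exists (fun i => nth 0 r i); split=> [i j /eqP|i].
  rewrite nth_uniq ?filter_uniq ?(leq_trans _ Nr)// => /eqP ij.
  exact: val_inj.
have : nth 0 r i \in r by apply: mem_nth; exact: leq_trans (ltn_ord i) Nr.
by rewrite mem_filter => /andP[].
Qed.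

(** Inverting the Vandermonde matrix of N points outside E writes each
coefficient as a combination of values. *)
Lemma module_poly_eq0 Z N (A : nat -> Z) (E : seq K) :
  (forall u, u \notin E -> \sum_(i < N) u ^+ i *: A i = 0) ->
  forall i, (i < N)%N -> A i = 0.
Proof.
move=> A0 i iN; have [u [uinj uE]] := exists_distinct_points E N.
pose M := Vandermonde N (\row_j u j).
have Mu : M \in unitmx.
  rewrite unitmxE det_Vandermonde unitfE; apply/prodf_neq0 => j _.
  apply/prodf_neq0 => k jk; rewrite !mxE subr_eq0 (inj_eq uinj).
  by apply: contraTneq jk => ->; rewrite ltnn.
have MV (k : 'I_N) :
    \sum_j invmx M j (Ordinal iN) * u j ^+ k = (k == Ordinal iN)%:R :> K.
  have /matrixP/(_ k (Ordinal iN)) := mulmxV Mu; rewrite !mxE => <-.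
  by apply: eq_bigr => j _; rewrite !mxE mulrC.
transitivity (\sum_(k < N) (k == Ordinal iN)%:R *: A k).
  rewrite (bigD1 (Ordinal iN))//= eqxx scale1r big1 ?addr0// => k /negPf ->.
  by rewrite scale0r.
transitivity (\sum_j invmx M j (Ordinal iN) *:
  (\sum_(k < N) u j ^+ k *: A k)); last first.
  by apply: big1 => j _; rewrite A0 ?scaler0.
under [RHS]eq_bigr do rewrite scaler_sumr.
rewrite exchange_big/=; apply: eq_bigr => k _.
by rewrite -MV scaler_suml; apply: eq_bigr => j _; rewrite scalerA.
Qed.

End ModulePolynomials.

Section Convolution.
Context {K : fieldType} {U V W : lmodType K} (h : U -> V -> W).

(** The Cauchy product along h; for a Lie bracket it is convertible to [conv]. *)
Definition hconv (f : nat -> U) (g : nat -> V) (k : nat) : W :=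
  \sum_(i < k.+1) h (f i) (g (k - i)%N).

Hypothesis hb : is_bilinear h.

(** All indices range up to a common bound, which makes exchanging sums easy. *)
Lemma hconvE f g k N : (k < N)%N -> hconv f g k =
  \sum_(i < N) \sum_(j < N) if (i + j == k)%N then h (f i) (g j) else 0.
Proof.
move=> kN; rewrite /hconv (big_ord_widen N (fun i => h (f i) (g (k - i)%N)))//.
rewrite big_mkcond/=; apply: eq_bigr => -[i /= iN] _.
have [ik|ki] := ltnP i k.+1; last first.
  by rewrite big1// => j _; case: eqP => // e; move: ki; lia.
have kiN : (k - i < N)%N by lia.
rewrite (bigD1 (Ordinal kiN))//= subnKC// eqxx big1 ?addr0// => -[j /= jN].
by move=> /eqP ne; case: eqP => // e; case: ne; apply: val_inj => /=; lia.
Qed.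

Lemma hconv_eval f g N M t : (forall i, (N <= i)%N -> f i = 0) ->
    (forall i, (M <= i)%N -> g i = 0) ->
  \sum_(k < N + M) t ^+ k *: hconv f g k =
  h (\sum_(i < N) t ^+ i *: f i) (\sum_(j < M) t ^+ j *: g j).
Proof.
move=> fN gM; pose P := (N + M)%N.
transitivity (\sum_(i < P) \sum_(j < P) t ^+ (i + j) *: h (f i) (g j)).
  transitivity (\sum_(k < P) \sum_(i < P) \sum_(j < P)
      if (i + j == k)%N then t ^+ (i + j) *: h (f i) (g j) else 0).
    apply: eq_bigr => k _; rewrite (hconvE f g (ltn_ord k)) scaler_sumr.
    apply: eq_bigr => i _; rewrite scaler_sumr; apply: eq_bigr => j _.
    by case: eqP => [->//|_]; rewrite scaler0.
  rewrite exchange_big/=; apply: eq_bigr => i _.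
  rewrite exchange_big/=; apply: eq_bigr => j _.
  have [ij|ij] := ltnP (i + j) P.
    rewrite (bigD1 (Ordinal ij))//= eqxx big1 ?addr0// => k /eqP ne.
    by case: eqP => // e; case: ne; apply: val_inj.
  rewrite big1 => [|k _]; last first.
    by case: eqP => // e; have := ltn_ord k; rewrite -e ltnNge ij.
  have [Ni|iN] := leqP N i; first by rewrite fN// (bilin0l hb) scaler0.
  have Mj : (M <= j)%N.
    by rewrite -(leq_add2l N) (leq_trans ij)// leq_add2r ltnW.
  by rewrite (gM j)// (bilin0r hb) scaler0.
have NP : (N <= P)%N by rewrite leq_addr.
have MP : (M <= P)%N by rewrite leq_addl.
rewrite (big_ord_widen P (fun i => t ^+ i *: f i) NP).
rewrite (big_ord_widen P (fun i => t ^+ i *: g i) MP).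
rewrite [X in h X _]big_mkcond [X in h _ X]big_mkcond/=.
rewrite (bilin_suml hb); apply: eq_bigr => i _.
rewrite (bilin_sumr hb); apply: eq_bigr => j _.
case: ifPn => [_|]; last first.
  by rewrite -leqNgt => /fN ->; rewrite !(bilin0l hb) scaler0.
case: ifPn => [_|].
  by rewrite (bilinZl hb) (bilinZr hb) scalerA exprD.
by rewrite -leqNgt => /gM ->; rewrite !(bilin0r hb) scaler0.
Qed.

End Convolution.

(** For h1 and h3 the Killing form and h2 and h4 the bracket, this transfers the
invariance of the Killing form to Laurent series. *)
Lemma hconv_assoc (K : fieldType) (U V W X Y Z : lmodType K)
    (h1 : X -> W -> Z) (h2 : U -> V -> X)
    (h3 : U -> Y -> Z) (h4 : V -> W -> Y) f u v n :
  is_bilinear h1 -> is_bilinear h3 ->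
  (forall x y z, h1 (h2 x y) z = h3 x (h4 y z)) ->
  hconv h1 (hconv h2 f u) v n = hconv h3 f (hconv h4 u v) n.
Proof.
move=> b1 b3 h1234.
transitivity (\sum_(m < n.+1) \sum_(i < n.+1) \sum_(j < n.+1)
    if (i + j == m)%N then h1 (h2 (f i) (u j)) (v (n - (i + j))%N) else 0).
  apply: eq_bigr => m _; rewrite (hconvE h2 _ _ (ltn_ord m)) (bilin_suml b1).
  apply: eq_bigr => i _; rewrite (bilin_suml b1); apply: eq_bigr => j _.
  by case: eqP => [->//|_]; rewrite (bilin0l b1).
rewrite exchange_big/=; apply: eq_bigr => i _.
rewrite exchange_big/= /hconv (bilin_sumr b3).
rewrite (big_ord_widen n.+1
  (fun j => h3 (f i) (h4 (u j) (v (n - i - j)%N)))) ?ltnS ?leq_subr//.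
rewrite [RHS]big_mkcond/=; apply: eq_bigr => j _.
have [ij|ij] := ltnP j (n - i).+1.
  have ijn : (i + j < n.+1)%N by have := ltn_ord i; lia.
  rewrite (bigD1 (Ordinal ijn))//= eqxx big1 ?addr0 => [|k /eqP ne].
    by rewrite h1234 subnDA.
  by case: eqP => // e; case: ne; apply: val_inj.
rewrite big1// => k _; case: eqP => // e.
by have := ltn_ord k; have := ltn_ord i; lia.
Qed.

Section PolyTheory.
Context {K : numFieldType} {V : lmodType K}.
Implicit Types a b : vpoly V.

Lemma vpoly_bounded a : exists N, forall k, (N <= k)%N -> a k = 0.
Proof. by case: a => a /= /asboolP. Qed.

Lemma pevalE N a z : (forall k, (N <= k)%N -> a k = 0) ->
  peval a z = \sum_(k < N) z ^+ k *: a k.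
Proof.
move=> aN; rewrite /peval (fsbigE (iota 0 N)) ?iota_uniq//.
  rewrite (eq_bigl xpredT); last by move=> i; rewrite in_setT.
  by rewrite -[iota 0 N]/(iota 0 N) -{1}[N]subn0 -/(index_iota 0 N) big_mkord.
by move=> i _; rewrite mem_iota add0n -leqNgt => /aN ->; rewrite scaler0.
Qed.

Lemma vpolyP c a b k : pcoef (c *: a + b) k = c *: a k + b k.
Proof. by []. Qed.

Lemma coef_linear k : linear (fun a : vpoly V => a k).
Proof. by []. Qed.

Lemma vpoly_eq a b : (forall k, pcoef a k = pcoef b k) -> a = b.
Proof. by move=> ab; apply: val_inj; apply/funext. Qed.

Lemma pcoef_sum I (r : seq I) (P : pred I) (F : I -> vpoly V) k :
  pcoef (\sum_(i <- r | P i) F i) k = \sum_(i <- r | P i) pcoef (F i) k.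
Proof. exact: (lin_sum _ _ _ (coef_linear k)). Qed.

Lemma vpoly_bounded2 a b :
  exists N, (forall k, (N <= k)%N -> a k = 0) /\
            (forall k, (N <= k)%N -> b k = 0).
Proof.
have [N aN] := vpoly_bounded a; have [M bM] := vpoly_bounded b.
by exists (maxn N M); split=> k; rewrite geq_max => /andP[? ?]; auto.
Qed.

Lemma peval_linear z : linear (fun a : vpoly V => peval a z).
Proof.
move=> c a b; have [N [aN bN]] := vpoly_bounded2 a b.
rewrite !(pevalE (N := N))//; last first.
  by move=> k Nk; rewrite vpolyP aN// bN// scaler0 addr0.
rewrite scaler_sumr -big_split/=; apply: eq_bigr => i _.
transitivity (z ^+ i *: (c *: a i + b i)); first by [].
by rewrite scalerDr !scalerA mulrC.
Qed.

Lemma mono_subproof n (x : V) :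
  (fun k => if k == n then x else 0) \in fin_supp.
Proof.
by apply/asboolP; exists n.+1 => k nk; case: eqP nk => // ->; rewrite ltnn.
Qed.

Definition mono n x : vpoly V := VPoly (mono_subproof n x).

Lemma mono_linear n : linear (mono n).
Proof.
move=> c x y; apply: val_inj; apply/funext => k /=.
transitivity (c *: (if k == n then x else 0) + (if k == n then y else 0)) => //.
by case: eqP => // _; rewrite scaler0 addr0.
Qed.

Lemma peval_mono n x z : peval (mono n x) z = z ^+ n *: x.
Proof.
rewrite (pevalE (N := n.+1)) => [|k nk].
  rewrite big_ord_recr/= eqxx big1 ?add0r// => -[i /= iN] _.
  by case: eqP iN => [->|]; rewrite ?ltnn// scaler0.
by rewrite /=; case: eqP nk => // ->; rewrite ltnn.
Qed.

Lemma vpoly_sum N a : (forall k, (N <= k)%N -> a k = 0) ->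
  a = \sum_(n < N) mono n (a n).
Proof.
move=> aN; apply: vpoly_eq => k; rewrite pcoef_sum/=.
have [kN|Nk] := ltnP k N.
  rewrite (bigD1 (Ordinal kN))//= eqxx big1 ?addr0// => i /eqP ne.
  by case: eqP => // e; case: ne; apply: val_inj.
by rewrite aN// big1// => i _; case: eqP => // e; move: Nk; rewrite e leqNgt ltn_ord.
Qed.

Lemma peval0 a : peval a 0 = a 0%N.
Proof.
have [N aN] := vpoly_bounded a.
rewrite (pevalE (N := N.+1)); last by move=> k /ltnW; exact: aN.
by rewrite big_ord_recl expr0 scale1r big1 ?addr0// => i _; rewrite expr0n scale0r.
Qed.

Lemma peval_lie (br : lieBracket V) a b z :
  peval (poly_lie br a b) z = br (peval a z) (peval b z).
Proof.
have [N aN] := vpoly_bounded a; have [M bM] := vpoly_bounded b.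
rewrite (pevalE _ aN) (pevalE _ bM).
rewrite -(hconv_eval (lie_bilinear br) _ aN bM) (pevalE (N := N + M))//.
move=> k k_ge /=; rewrite /conv big1// => -[i /= ik] _.
have bb := lie_bilinear br.
have [Ni|iN] := leqP N i; first by rewrite aN// (bilin0l bb).
by rewrite bM ?(bilin0r bb)//; lia.
Qed.

End PolyTheory.

Section TensorEvaluation.
Context {K : numFieldType} {V : lmodType K}.

(** Elements of V[u] (x) V[v] are handled as (V (x) V)-valued polynomials in two
variables. *)
Definition eval2 (u v : K) : tensor (vpoly V) (vpoly V) -> tensor V V :=
  tmap (peval^~ u) (peval^~ v).

Definition mono2 i j : tensor V V -> tensor (vpoly V) (vpoly V) :=
  tmap (mono i) (mono j).

Lemma eval2_linear u v : linear (eval2 u v).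
Proof. by apply: tmap_linear; exact: peval_linear. Qed.

Lemma eval2_tens u v a b : eval2 u v (tens a b) = tens (peval a u) (peval b v).
Proof. by apply: tmap_tens; exact: peval_linear. Qed.

Lemma eval2_mono2 u v i j t : eval2 u v (mono2 i j t) = (u ^+ i * v ^+ j) *: t.
Proof.
move: t; apply: tensor_ext => [||x y].
- apply: linear_comp; first exact: eval2_linear.
  by apply: tmap_linear; exact: mono_linear.
- by apply: linear_scale => c x y.
rewrite /mono2 tmap_tens ?eval2_tens ?peval_mono; try exact: mono_linear.
by rewrite (bilinZl tens_bilinear) (bilinZr tens_bilinear) scalerA.
Qed.

Definition coef2 i j : tensor (vpoly V) (vpoly V) -> tensor V V :=
  tmap (fun a : vpoly V => a i) (fun a : vpoly V => a j).

Lemma tensor2_bounded (t : tensor (vpoly V) (vpoly V)) :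
  exists N, forall p, p \in repr t -> (forall k, (N <= k)%N -> p.1 k = 0) /\
    (forall k, (N <= k)%N -> p.2 k = 0).
Proof.
elim: (repr t) => [|[b a] s [N sN]]; first by exists 0%N.
have [M [bM aM]] := vpoly_bounded2 b a; exists (maxn N M) => p.
rewrite inE => /orP[/eqP ->|ps].
  by split=> k; rewrite geq_max => /andP[? ?]; [exact: bM|exact: aM].
by have [? ?] := sN _ ps; split=> k; rewrite geq_max => /andP[? ?]; auto.
Qed.

Lemma tensor2_sum (t : tensor (vpoly V) (vpoly V)) : exists N,
  t = \sum_(i < N) \sum_(j < N) mono2 i j (coef2 i j t).
Proof.
have [N tN] := tensor2_bounded t; exists N.
pose G := fun t : tensor (vpoly V) (vpoly V) =>
  \sum_(i < N) \sum_(j < N) mono2 i j (coef2 i j t).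
have mono2_lin i j : linear (mono2 i j).
  by apply: tmap_linear; exact: mono_linear.
have coef2_lin i j : linear (coef2 i j).
  by apply: tmap_linear; exact: coef_linear.
have Gl : linear G.
  do 2 apply: linear_sum_fun => ?; exact: linear_comp.
rewrite -/(G t) [in RHS](tensor_sum t) (lin_sum _ _ _ Gl) {1}(tensor_sum t).
rewrite !big_seq; apply: eq_bigr => -[a b] /tN/= [aN bN].
rewrite {1}(vpoly_sum aN) (bilin_suml tens_bilinear); apply: eq_bigr => i _.
rewrite {1}(vpoly_sum bN) (bilin_sumr tens_bilinear); apply: eq_bigr => j _.
by rewrite /mono2 /coef2 !tmap_tens//; exact: mono_linear.
Qed.

(** An element is a combination of monomials with coefficients in V (x) V; for a
fixed v outside E, the values at u outside v :: E determine the coefficients in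
u, which are polynomials in v.  The exceptional set is used to avoid the point 0,
which is needed as the third argument of the Yang-Baxter equation. *)
Lemma eval2_inj (E : seq K) (s t : tensor (vpoly V) (vpoly V)) :
  (forall u v, u \notin E -> v \notin E -> u != v ->
     eval2 u v s = eval2 u v t) -> s = t.
Proof.
move=> st; apply/eqP; rewrite -subr_eq0; apply/eqP.
set d := s - t.
have d0 u v : u \notin E -> v \notin E -> u != v -> eval2 u v d = 0.
  by move=> uE vE uv; rewrite (linB _ _ (eval2_linear u v)) st// subrr.
have [N dN] := tensor2_sum d.
have evd u v : eval2 u v d =
    \sum_(i < N) u ^+ i *: \sum_(j < N) v ^+ j *: coef2 i j d.
  rewrite {1}dN (lin_sum _ _ _ (eval2_linear u v)); apply: eq_bigr => i _.
  rewrite (lin_sum _ _ _ (eval2_linear u v)) scaler_sumr.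
  by apply: eq_bigr => j _; rewrite eval2_mono2 scalerA.
have c0 i j : (i < N)%N -> (j < N)%N -> coef2 i j d = 0.
  move=> iN; apply: (@module_poly_eq0 _ _ N (fun j => coef2 i j d) E) => v vE.
  apply: (@module_poly_eq0 _ _ N
    (fun i => \sum_(j < N) v ^+ j *: coef2 i j d) (v :: E)) => // u.
  by rewrite inE negb_or => /andP[uv uE]; rewrite -evd d0.
have mono20 i j : mono2 i j 0 = 0.
  by apply: lin0; apply: tmap_linear; exact: mono_linear.
rewrite dN big1// => i _; rewrite big1// => j _.
by rewrite c0.
Qed.

(** The functions X(u, v) themselves have a pole at u = v; closure properties of
this predicate replace an explicit formula for the cobracket. *)
Definition polynomial_off_diagonal (F : K -> K -> tensor V V) :=
  exists d : tensor (vpoly V) (vpoly V),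
    forall u v, u != v -> eval2 u v d = F u v.

Lemma off_diagonal_add F G : polynomial_off_diagonal F -> polynomial_off_diagonal G ->
  polynomial_off_diagonal (fun u v => F u v + G u v).
Proof.
move=> [d dF] [e eG]; exists (d + e) => u v uv.
by rewrite (linD _ _ (eval2_linear u v)) dF// eG.
Qed.

Lemma off_diagonal_sum I (r : seq I) (F : I -> K -> K -> tensor V V) :
  (forall i, polynomial_off_diagonal (F i)) ->
  polynomial_off_diagonal (fun u v => \sum_(i <- r) F i u v).
Proof.
move=> FP; elim: r => [|i r IH].
  by exists 0 => u v uv; rewrite big_nil (lin0 (eval2_linear u v)).
have [d dF] := off_diagonal_add (FP i) IH; exists d => u v uv.
by rewrite dF// big_cons.
Qed.

Lemma off_diagonal_mono i j t :
  polynomial_off_diagonal (fun u v => (u ^+ i * v ^+ j) *: t).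
Proof. by exists (mono2 i j t) => u v uv; rewrite eval2_mono2. Qed.

Lemma off_diagonal_eq F G : (forall u v, u != v -> F u v = G u v) ->
  polynomial_off_diagonal F -> polynomial_off_diagonal G.
Proof. by move=> FG [d dF]; exists d => u v uv; rewrite dF// FG. Qed.

End TensorEvaluation.

(** * Expansion at infinity of functions with a simple pole *)

Section LaurentConvolution.
Context {K : numFieldType} {U V W : lmodType K} (h : U -> V -> W).
Hypothesis hb : is_bilinear h.

(** A Laurent series bounded by degree N is read from the top: the coefficient of
u^(N - k) becomes the k-th coefficient of a power series in 1/u. *)
Lemma fsbig_hconv N M (f : int -> U) (g : int -> V) (c : nat) :
    (forall k, N < k -> f k = 0) -> (forall k, M < k -> g k = 0) ->
  \sum_(i \in [set: int]) h (f i) (g (N + M - c%:Z - i)) =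
  hconv h (fun k => f (N - k%:Z)) (fun k => g (M - k%:Z)) c.
Proof.
move=> fN gM.
rewrite (fsbigE [seq N - a%:Z | a <- iota 0 c.+1])//.
- rewrite (eq_bigl xpredT); last by move=> i; rewrite in_setT.
  rewrite big_map -[iota 0 _]/(index_iota 0 c.+1) big_mkord.
  by apply: eq_bigr => -[i /= ic] _; congr (h _ (g _)); lia.
- by rewrite map_inj_uniq ?iota_uniq// => x y /addrI/oppr_inj[].
- move=> i _ ir; have [Ni|iN] := ltP N i; first by rewrite fN// (bilin0l hb).
  rewrite gM ?(bilin0r hb)//; apply: contraNlt ir => le_M.
  by apply/mapP; exists `|N - i|%N; [rewrite mem_iota|]; lia.
Qed.

End LaurentConvolution.

Section OneMinusVT.
Context {K : numFieldType}.
Implicit Types U V W : lmodType K.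

(** The coefficients of (1 - v t) f(t). *)
Definition mul1V U (v : K) (f : nat -> U) (k : nat) : U :=
  f k - v *: (if k is k'.+1 then f k' else 0).

Lemma mul1V_inj U v (f : nat -> U) :
  (forall k, mul1V v f k = 0) -> forall k, f k = 0.
Proof.
move=> f0; elim=> [|k IH]; have := f0 _; rewrite /mul1V.
  by move=> /(_ 0%N); rewrite scaler0 subr0.
by move=> /(_ k.+1); rewrite IH scaler0 subr0.
Qed.

Lemma mul1V_lin U V v (F : U -> V) f k : linear F ->
  mul1V v (fun k => F (f k)) k = F (mul1V v f k).
Proof.
by move=> lF; rewrite /mul1V; case: k => [|k]; rewrite (linB _ _ lF) (linZ _ _ lF) ?(lin0 lF).
Qed.

Lemma mul1VB U v (f g : nat -> U) k :
  mul1V v (fun k => f k - g k) k = mul1V v f k - mul1V v g k.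
Proof.
rewrite /mul1V; case: k => [|k]; first by rewrite !scaler0 !subr0.
rewrite scalerBr !opprB [v *: g k - v *: f k]addrC.
by rewrite [v *: g k - g k.+1]addrC addrACA.
Qed.

Lemma mul1VC U v w (f : nat -> U) k :
  mul1V v (mul1V w f) k = mul1V w (mul1V v f) k.
Proof.
have dist a (x y z : U) : x - a *: (y - z) = x - a *: y + a *: z.
  by rewrite scalerBr opprB addrA addrAC.
rewrite /mul1V; case: k => [|k]; first by rewrite !scaler0 !subr0.
rewrite !dist !scalerA [w * v]mulrC; congr (_ + _).
by rewrite addrAC.
Qed.

Lemma mul1V_ext U v (f g : nat -> U) k : f =1 g -> mul1V v f k = mul1V v g k.
Proof. by move=> fg; rewrite /mul1V fg; case: k => // k; rewrite fg. Qed.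

Lemma hconv_mul1V U V W (h : U -> V -> W) v f g k : is_bilinear h ->
  hconv h (mul1V v f) g k = mul1V v (hconv h f g) k.
Proof.
move=> hb; rewrite /hconv /mul1V.
under eq_bigr do rewrite -scaleN1r scalerA (bilinDl hb) (bilinZl hb).
rewrite big_split/= -scaler_sumr mulN1r scaleNr; congr (_ - _ *: _).
rewrite big_ord_recl (bilin0l hb) add0r; case: k => [|k]; first by rewrite big_ord0.
by apply: eq_bigr => i _; congr (h _ (g _)); rewrite /bump/=; lia.
Qed.

Lemma hconv_mul1Vr U V W (h : U -> V -> W) v f g k : is_bilinear h ->
  hconv h f (mul1V v g) k = mul1V v (hconv h f g) k.
Proof.
move=> hb.
have flip (f' : nat -> U) (g' : nat -> V) j :
    hconv h f' g' j = hconv (fun y x => h x y) g' f' j.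
  rewrite /hconv (reindex_inj rev_ord_inj)/=; apply: eq_bigr => -[i /= ij] _.
  by rewrite subSS subKn.
rewrite flip hconv_mul1V; last exact: bilinear_flip.
by apply: mul1V_ext => j; rewrite flip.
Qed.

Definition shift U N (f : nat -> U) k : U := if (k < N)%N then 0 else f (k - N)%N.

Lemma mul1V_shift U v N (f : nat -> U) k :
  mul1V v (shift N f) k = shift N (mul1V v f) k.
Proof.
rewrite /mul1V /shift; have [kN|Nk] := ltnP k N.
  case: k kN => [|k] kN; first by rewrite scaler0 subr0.
  by rewrite (ltnW kN) scaler0 subr0.
case: k Nk => [|k] Nk; first by rewrite sub0n.
have [kN|Nk'] := ltnP k N; last by rewrite subSn.
by have -> : (k.+1 - N = 0)%N by lia.
Qed.

Lemma eval_mul1V U v t M (f : nat -> U) : (forall k, (M <= k)%N -> f k = 0) ->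
  \sum_(k < M.+1) t ^+ k *: mul1V v f k =
  (1 - v * t) *: \sum_(k < M) t ^+ k *: f k.
Proof.
move=> fM; under eq_bigr do rewrite /mul1V scalerBr scalerA.
rewrite sumrB scalerBl scale1r; congr (_ - _).
  by rewrite big_ord_recr/= fM// scaler0 addr0.
rewrite big_ord_recl scaler0 add0r scaler_sumr; apply: eq_bigr => i _.
by rewrite /bump/= scalerA exprS; congr (_ *: _); rewrite mulrC mulrA.
Qed.

Lemma eval_widen U t M P (f : nat -> U) : (M <= P)%N ->
  (forall k, (M <= k)%N -> f k = 0) ->
  \sum_(k < P) t ^+ k *: f k = \sum_(k < M) t ^+ k *: f k.
Proof.
move=> MP fM; rewrite (big_ord_widen P (fun i => t ^+ i *: f i) MP).
rewrite [RHS]big_mkcond/=; apply: eq_bigr => i _.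
by case: ltnP => // /fM ->; rewrite scaler0.
Qed.

Lemma eval_shift U t N P (f : nat -> U) :
  \sum_(k < N + P) t ^+ k *: shift N f k = t ^+ N *: \sum_(k < P) t ^+ k *: f k.
Proof.
rewrite big_split_ord/= big1 ?add0r => [|i _]; last first.
  by rewrite /shift ltn_ord scaler0.
rewrite scaler_sumr; apply: eq_bigr => i _.
by rewrite /shift ltnNge leq_addr/= addKn scalerA exprD.
Qed.

(** The coefficient of u^n in F(u) + v/(u - v) a, expanded at infinity, where
v/(u - v) is the sum of the v^k u^-k over k > 0. *)
Definition polar_coef U (F : nat -> U) (a : U) (v : K) (n : int) : U :=
  match n with Posz i => F i | Negz i => v ^+ i.+1 *: a end.

Definition polar_eval U N (F : nat -> U) (a : U) (v u : K) : U :=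
  \sum_(i < N.+1) u ^+ i *: F i + (v / (u - v)) *: a.

Section Reversed.
Context U (N : nat) (F : nat -> U) (a : U) (v : K).

(** The coefficients of u^-N (F(u) + v/(u - v) a) as a power series in t = 1/u. *)
Definition polar_rev (k : nat) : U := polar_coef F a v (N%:Z - k%:Z).

Lemma polar_rev_low k : (k <= N)%N -> polar_rev k = F (N - k)%N.
Proof. by move=> kN; rewrite /polar_rev subzn. Qed.

Lemma polar_rev_high k : polar_rev (N + k.+1) = v ^+ k.+1 *: a.
Proof.
rewrite /polar_rev; have -> : N%:Z - (N + k.+1)%:Z = Negz k by lia.
by [].
Qed.

(** Multiplying by 1 - v/u clears the pole, so that a polynomial in 1/u of degree
at most N + 1 remains. *)
Lemma mul1V_polar_rev k : (N.+2 <= k)%N -> mul1V v polar_rev k = 0.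
Proof.
move=> Nk; have [j ->] : exists j, k = (N + j.+2)%N.
  by exists (k - N.+2)%N; lia.
rewrite addnS /mul1V -addnS !polar_rev_high [v ^+ j.+2]exprS -scalerA.
by rewrite subrr.
Qed.

(** The contribution of the pole is the single coefficient v a of t^(N + 1). *)
Lemma eval_mul1V_polar_rev u : u != 0 -> u != v ->
  \sum_(k < N.+2) u^-1 ^+ k *: mul1V v polar_rev k =
  ((1 - v * u^-1) * u^-1 ^+ N) *: polar_eval N F a v u.
Proof.
move=> u0 uv.
pose f k := if (k <= N)%N then polar_rev k else 0.
pose e k := if (k == N.+1)%N then v *: a else 0.
have E k : (k < N.+2)%N -> mul1V v polar_rev k = mul1V v f k + e k.
  rewrite ltnS leq_eqVlt /e => /orP[/eqP ->|kN].
    rewrite eqxx /mul1V /f ltnn leqnn sub0r -[N.+1]addn1 polar_rev_high expr1.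
    by rewrite addrC.
  rewrite (ltn_eqF kN) addr0 /mul1V /f; rewrite ltnS in kN; rewrite kN.
  by case: k kN => // k kN; rewrite (ltnW kN).
rewrite (eq_bigr (fun k : 'I_N.+2 =>
  u^-1 ^+ k *: mul1V v f k + u^-1 ^+ k *: e k)); last first.
  by move=> k _; rewrite E// scalerDr.
rewrite big_split/= eval_mul1V; last by move=> k; rewrite /f ltnNge => /negbTE ->.
rewrite /polar_eval scalerDr -!scalerA; congr (_ + _).
  congr (_ *: _); rewrite scaler_sumr (reindex_inj rev_ord_inj)/=.
  apply: eq_bigr => -[i /= iN] _; rewrite /f subSS leq_subr polar_rev_low ?leq_subr//.
  rewrite subKn// scalerA; congr (_ *: _).
  rewrite -{2}(subnK (n := N) (m := i))// exprD -mulrA -exprMn mulVf// expr1n.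
  by rewrite mulr1.
rewrite big_ord_recr/= /e eqxx big1 ?add0r => [|i _]; last first.
  by rewrite (ltn_eqF (ltn_ord i)) scaler0.
rewrite !scalerA; congr (_ *: _).
have uv' : u - v != 0 by rewrite subr_eq0.
have -> : 1 - v / u = (u - v) / u by rewrite mulrBl divff.
rewrite exprS; set p := u^-1 ^+ N.
transitivity (u^-1 * p * v * ((u - v) / (u - v))).
  by rewrite divff// mulr1.
by ring.
Qed.

End Reversed.

(** Let L be the power series in t = 1/u of u^(-2N) times the difference of the
two sides.  Then (1 - v t)(1 - w t) L has finitely many coefficients, and its
value at t = 1/u vanishes for almost all u by assumption; hence it is zero, and
so is L. *)
Lemma polar_identity U V W (h : U -> V -> W) (k1 : U -> W) (k2 : V -> W)
    (N : nat) (F : nat -> U) (G : nat -> V) a b v w (E : seq K) :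
  is_bilinear h -> linear k1 -> linear k2 ->
  (forall i, (N < i)%N -> F i = 0) -> (forall i, (N < i)%N -> G i = 0) ->
  (forall u, u \notin E ->
     h (polar_eval N F a v u) (polar_eval N G b w u) =
     k1 (polar_eval N F a v u) + k2 (polar_eval N G b w u)) ->
  forall c : nat, let n := N%:Z + N%:Z - c%:Z in
    hconv h (polar_rev N F a v) (polar_rev N G b w) c =
    k1 (polar_coef F a v n) + k2 (polar_coef G b w n).
Proof.
move=> hb lk1 lk2 FN GN hk c /=.
have FB k : N%:Z < k -> polar_coef F a v k = 0.
  by case: k => // k; rewrite ltz_nat; exact: FN.
have GB k : N%:Z < k -> polar_coef G b w k = 0.
  by case: k => // k; rewrite ltz_nat; exact: GN.
pose f := polar_rev N F a v; pose g := polar_rev N G b w.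
(* The shift accounts for x(u) carrying a factor u^-N where L carries u^(-2N). *)
pose L k := hconv h f g k - shift N (fun k => k1 (f k)) k
              - shift N (fun k => k2 (g k)) k.
suff L0 : forall k, L k = 0.
  have /eqP := L0 c; rewrite /L -addrA -opprD subr_eq0 => /eqP ->.
  rewrite /shift; case: ltnP => cN.
    have Nc : N%:Z < N%:Z + N%:Z - c%:Z by lia.
    by rewrite FB// GB// (lin0 lk1) (lin0 lk2).
  rewrite /f /g /polar_rev.
  have -> : N%:Z - (c - N)%N%:Z = N%:Z + N%:Z - c%:Z by lia.
  by [].
pose L' k := hconv h (mul1V v f) (mul1V w g) k
  - shift N (fun k => k1 (mul1V w (mul1V v f) k)) k
  - shift N (fun k => k2 (mul1V v (mul1V w g) k)) k.
have LE k : mul1V v (mul1V w L) k = L' k.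
  rewrite (mul1V_ext v k (mul1VB w _ _)) mul1VB /L'; congr (_ - _).
    rewrite (mul1V_ext v k (mul1VB w _ _)) mul1VB; congr (_ - _).
      rewrite hconv_mul1V//; apply: mul1V_ext => j; rewrite hconv_mul1Vr//.
    rewrite (mul1V_ext v k (mul1V_shift w _ _)) mul1V_shift /shift.
    case: ifP => // _; rewrite mul1VC -[RHS]mul1V_lin//; apply: mul1V_ext => j.
    exact: mul1V_lin.
  rewrite (mul1V_ext v k (mul1V_shift w _ _)) mul1V_shift /shift.
  case: ifP => // _; rewrite -[RHS]mul1V_lin//; apply: mul1V_ext => j.
  exact: mul1V_lin.
(* L' = (1 - v t)(1 - w t) L is a polynomial in t of degree less than P. *)
apply: (@mul1V_inj _ w); apply: (@mul1V_inj _ v) => k; rewrite LE.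
pose P := (N.+2 + N.+2)%N.
have fv j : (N.+2 <= j)%N -> mul1V v f j = 0 by exact: mul1V_polar_rev.
have gw j : (N.+2 <= j)%N -> mul1V w g j = 0 by exact: mul1V_polar_rev.
have fvw j : (N.+3 <= j)%N -> mul1V w (mul1V v f) j = 0.
  by case: j => // j jN; rewrite {1}/mul1V !fv ?scaler0 ?subr0//; exact: ltnW.
have gvw j : (N.+3 <= j)%N -> mul1V v (mul1V w g) j = 0.
  by case: j => // j jN; rewrite {1}/mul1V !gw ?scaler0 ?subr0//; exact: ltnW.
have [kP|Pk] := ltnP k P; last first.
  rewrite /L' /hconv big1 => [|i _]; last first.
    have [iN|Ni] := leqP N.+2 i; first by rewrite fv// (bilin0l hb).
    by rewrite gw ?(bilin0r hb)//; rewrite /P in Pk; lia.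
  rewrite /shift; case: ifP => _; first by rewrite !subr0.
  have Nk : (N.+3 <= k - N)%N by rewrite /P in Pk; lia.
  by rewrite fvw// gvw// (lin0 lk1) (lin0 lk2) !subr0.
apply: (@module_poly_eq0 _ _ P L' [:: 0 & [seq x^-1 | x <- v :: w :: E]]) => // t.
rewrite inE negb_or => /andP[t0 tE]; pose u := t^-1.
have tu : t = u^-1 by rewrite /u invrK.
have u0 : u != 0 by rewrite invr_eq0.
have : u \notin v :: w :: E.
  by apply: contra tE => uE; rewrite tu; exact: map_f.
rewrite !inE !negb_or => /and3P[uv uw uE].
rewrite /L'; under eq_bigr do rewrite !scalerBr.
rewrite !sumrB hconv_eval//.
have -> : P = (N + N.+4)%N by rewrite /P; lia.
rewrite !eval_shift.
have k1E Q : \sum_(k < Q) t ^+ k *: k1 (mul1V w (mul1V v f) k) =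
    k1 (\sum_(k < Q) t ^+ k *: mul1V w (mul1V v f) k).
  by rewrite (lin_sum _ _ _ lk1); apply: eq_bigr => i _; rewrite (linZ _ _ lk1).
have k2E Q : \sum_(k < Q) t ^+ k *: k2 (mul1V v (mul1V w g) k) =
    k2 (\sum_(k < Q) t ^+ k *: mul1V v (mul1V w g) k).
  by rewrite (lin_sum _ _ _ lk2); apply: eq_bigr => i _; rewrite (linZ _ _ lk2).
rewrite k1E k2E (eval_widen _ _ fvw)// (eval_widen _ _ gvw)//.
rewrite (eval_mul1V _ _ fv) (eval_mul1V _ _ gw) tu /f /g.
rewrite !eval_mul1V_polar_rev// (bilinZl hb) (bilinZr hb) hk//.
rewrite !(linZ _ _ lk1) !(linZ _ _ lk2) !scalerA.
set A := k1 _; set B := k2 _; rewrite scalerDr.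
set p := u^-1 ^+ N.
set x := 1 - v / u; set y := 1 - w / u.
have -> : x * p * (y * p) = p * y * (x * p) by ring.
have -> : p * (x * (y * p)) = p * (y * (x * p)) by ring.
by rewrite -[p * y * _]mulrA addrAC addrK subrr.
Qed.

End OneMinusVT.

(** * The Killing form, the Casimir element and the form Q *)

Section Killing.
Context {K : fieldType} {g : vectType K} (br : lieBracket g).
Local Notation kil := (killing br).
Local Notation e := (vbasis {:g}).

HB.instance Definition _ (x : g) := GRing.isLinear.Build K g g *:%R
  (lie_op br x) ((lie_bilinear br).2 x).

Definition ad_mx (x : g) := passmx.mxof e e (linfun (br x)).

Lemma ad_mx_linear : linear ad_mx.
Proof.
move=> a x y; rewrite /ad_mx -passmx.mxof_linear; congr (passmx.mxof _ _ _).
apply/lfunP => z; rewrite add_lfunE scale_lfunE !lfunE/=.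
by rewrite (bilinDl (lie_bilinear br)) (bilinZl (lie_bilinear br)).
Qed.

Lemma killingE x y : kil x y = \tr (ad_mx y *m ad_mx x).
Proof. by rewrite /killing (passmx.mxof_comp _ _ (vbasisP _)). Qed.

(** Matrices act on row vectors, which reverses the order of products. *)
Lemma ad_mx_lie x y : ad_mx (br x y) = ad_mx y *m ad_mx x - ad_mx x *m ad_mx y.
Proof.
rewrite /ad_mx -!(passmx.mxof_comp _ _ (vbasisP _)).
rewrite -(linB _ _ (@passmx.mxof_linear _ _ _ e e)).
congr (passmx.mxof _ _ _); apply/lfunP => z.
rewrite add_lfunE opp_lfunE !comp_lfunE !lfunE/=.
have := lie_jacobi br x y z; have b := lie_bilinear br.
rewrite (lie_anti br z (br x y)) (lie_anti br z x) => /eqP.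
by rewrite -scaleN1r (bilinZr b) scaleN1r subr_eq0 => /eqP <-.
Qed.

Lemma killingC x y : kil x y = kil y x.
Proof. by rewrite !killingE mxtrace_mulC. Qed.

Lemma killing_bilinear : is_bilinear (kil : g -> g -> K^o).
Proof.
have l y : linear (kil^~ y : g -> K^o).
  by move=> a x x'; rewrite !killingE ad_mx_linear mulmxDr -scalemxAr linearP.
by split=> // x a y y'; rewrite ![kil x _]killingC; exact: l.
Qed.

Lemma killing_invariant x y z : kil (br x y) z = kil x (br y z).
Proof.
rewrite !killingE !ad_mx_lie mulmxBr mulmxBl !linearB/=; congr (_ - _).
  by rewrite mulmxA.
by rewrite mulmxA mxtrace_mulC mulmxA.
Qed.

End Killing.

Section Casimir.
Context {K : fieldType} {g : vectType K} (br : lieBracket g) (Omega : tensor g g).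
Local Notation kil := (killing br).
Hypothesis cas : is_casimir br Omega.

Let kb := killing_bilinear br.
Let tb := @tens_bilinear K g g.

(** Both expansions along the dual bases; all properties of the Casimir element
are read off them. *)
Lemma casimirP : exists n (e f : 'I_n -> g),
  [/\ Omega = \sum_i tens (e i) (f i), forall y, y = \sum_i kil y (f i) *: e i
    & forall y, y = \sum_i kil (e i) y *: f i].
Proof.
have [e [f [eb fb ef ->]]] := cas.
exists (\dim {:g}), (tnth e), (tnth f); split=> // y.
- have {1}-> := coord_basis eb (memvf y); apply: eq_bigr => i _.
  rewrite (tnth_nth 0 e); congr (_ *: _).
  rewrite {2}(coord_basis eb (memvf y)) (bilin_suml kb) (bigD1 i)//=.
  rewrite (bilinZl kb) -!tnth_nth ef eqxx big1 ?addr0 => [|j ji].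
    by rewrite [RHS]mulr1.
  by rewrite (bilinZl kb) -!tnth_nth ef (negPf ji) scaler0.
- have {1}-> := coord_basis fb (memvf y); apply: eq_bigr => i _.
  rewrite (tnth_nth 0 f); congr (_ *: _).
  rewrite {2}(coord_basis fb (memvf y)) (bilin_sumr kb) (bigD1 i)//=.
  rewrite (bilinZr kb) -!tnth_nth ef eqxx big1 ?addr0 => [|j ji].
    by rewrite [RHS]mulr1.
  by rewrite (bilinZr kb) -!tnth_nth ef eq_sym (negPf ji) scaler0.
Qed.

Lemma killing_nondeg y : (forall z, kil y z = 0) -> y = 0.
Proof.
move=> y0; have [n [e [f [_ ye _]]]] := casimirP.
by rewrite [y]ye big1// => i _; rewrite y0 scale0r.
Qed.

(** Expand e_i along the f_j; the coefficients K(e_j, e_i) are symmetric, and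
summing over i instead gives back e_j. *)
Lemma casimir_flip : tflip Omega = Omega.
Proof.
have [n [e [f [-> ye yf]]]] := casimirP.
rewrite (lin_sum _ _ _ (@tflip_linear _ _)).
under eq_bigr do rewrite tflip_tens.
transitivity (\sum_i \sum_j kil (e j) (e i) *: tens (f i) (f j)).
  apply: eq_bigr => i _; rewrite {1}[e i]yf (bilin_sumr tb).
  by apply: eq_bigr => j _; rewrite (bilinZr tb).
rewrite exchange_big/=; apply: eq_bigr => j _.
rewrite {2}[e j]yf (bilin_suml tb); apply: eq_bigr => i _.
by rewrite (bilinZl tb) killingC.
Qed.

(** Expanding [e_i, x] along the e_j and [f_i, x] along the f_j, the coefficients
of e_j (x) f_i are K([e_i, x], f_j) and K(e_i, [f_j, x]), which are opposite by
invariance of the Killing form. *)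
Lemma casimir_invariant x : tbr br Omega x x = 0.
Proof.
have [n [e [f [-> ye yf]]]] := casimirP.
rewrite (lin_sum _ _ _ (tbr_linear br x x)).
under eq_bigr do rewrite tbr_tens.
rewrite big_split/=.
have -> : \sum_i tens (br (e i) x) (f i) =
    \sum_i \sum_j kil (br (e i) x) (f j) *: tens (e j) (f i).
  apply: eq_bigr => i _; rewrite {1}[br _ _]ye (bilin_suml tb).
  by apply: eq_bigr => j _; rewrite (bilinZl tb).
have -> : \sum_i tens (e i) (br (f i) x) =
    \sum_i \sum_j kil (e j) (br (f i) x) *: tens (e i) (f j).
  apply: eq_bigr => i _; rewrite {1}[br _ _]yf (bilin_sumr tb).
  by apply: eq_bigr => j _; rewrite (bilinZr tb).
rewrite [X in _ + X]exchange_big -big_split/= big1// => i _.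
rewrite -big_split/= big1// => j _; rewrite -scalerDl killing_invariant.
rewrite (lie_anti br (f j) x) -scaleN1r (bilinZr kb) scaleN1r.
by rewrite subrr scale0r.
Qed.

End Casimir.

Section FormQ.
Context {K : numFieldType} {g : vectType K} (br : lieBracket g).
Local Notation kil := (killing br : g -> g -> K^o).
Implicit Types s t r : vlaurent g * g.

Let kb := killing_bilinear br.

(** The free term of a product is the coefficient of index N + M when both series
are read from their top degrees; natural bounds ensure that this index is not
negative. *)
Lemma QformE (N M : nat) s t : bounded_by N s.1 -> bounded_by M t.1 ->
  Qform br s t = hconv kil (fun k => s.1 (N%:Z - k%:Z))
    (fun k => t.1 (M%:Z - k%:Z)) (N + M) - kil s.2 t.2 :> K^o.
Proof.
move=> sN tM; rewrite /Qform; congr (_ - _).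
rewrite -(fsbig_hconv kb (N + M) sN tM).
by apply: eq_fsbigr => k _; congr (kil _ (t.1 _)); lia.
Qed.

Lemma bounded_natP (f : vlaurent g) : exists N : nat, bounded_by N%:Z f.
Proof.
have [N fN] := vlaurent_bounded f; exists (absz N).
by apply: bounded_by_le fN; lia.
Qed.

Lemma bounded_nat2 (f f' : vlaurent g) :
  exists N : nat, bounded_by N%:Z f /\ bounded_by N%:Z f'.
Proof.
have [N fN] := bounded_natP f; have [M fM] := bounded_natP f'.
exists (maxn N M); split; [apply: bounded_by_le fN|apply: bounded_by_le fM]; lia.
Qed.

Lemma QformC s t : Qform br s t = Qform br t s.
Proof.
have [N [sN tN]] := bounded_nat2 s.1 t.1.
rewrite (QformE sN tN) (QformE tN sN) killingC; congr (_ - _).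
rewrite /hconv (reindex_inj rev_ord_inj)/=; apply: eq_bigr => -[i /= ij] _.
by rewrite subSS subKn// killingC.
Qed.

Lemma Qform_bilinear : is_bilinear (Qform br : _ -> _ -> K^o).
Proof.
have l t : linear (Qform br ^~ t : _ -> K^o).
  move=> a s s'; have [N [sN sN']] := bounded_nat2 s.1 s'.1.
  have [M tM] := bounded_natP t.1.
  have slin : bounded_by N%:Z (a *: s + s').1 := bounded_lin a sN sN'.
  rewrite (QformE slin tM) (QformE sN tM) (QformE sN' tM).
  rewrite scalerBr addrACA -opprD; congr (_ - _); last exact: (kb.1 t.2 a s.2 s'.2).
  rewrite /hconv scaler_sumr -big_split; apply: eq_bigr => i _.
  exact: (kb.1 _ a (s.1 _) (s'.1 _)).
by split=> // s a t t'; rewrite ![Qform br s _]QformC; exact: l.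
Qed.

Lemma Qform_invariant r s t :
  Qform br (dsum_lie (laurent_lie br) br r s) t =
  Qform br r (dsum_lie (laurent_lie br) br s t).
Proof.
have [N0 [rN sN]] := bounded_nat2 r.1 s.1; have [M tM] := bounded_natP t.1.
pose N := maxn N0 M.
have {}rN : bounded_by N%:Z r.1 by apply: bounded_by_le rN; rewrite /N; lia.
have {}sN : bounded_by N%:Z s.1 by apply: bounded_by_le sN; rewrite /N; lia.
have {}tM : bounded_by N%:Z t.1 by apply: bounded_by_le tM; rewrite /N; lia.
pose rs := dsum_lie (laurent_lie br) br r s.
pose st := dsum_lie (laurent_lie br) br s t.
have rsN : bounded_by (N + N)%N%:Z rs.1 by rewrite PoszD; exact: lconv_bounded.
have stN : bounded_by (N + N)%N%:Z st.1 by rewrite PoszD; exact: lconv_bounded.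
rewrite -/rs -/st (QformE rsN tM) (QformE rN stN).
rewrite killing_invariant; congr (_ - _).
rewrite (_ : (fun k : nat => rs.1 _) =
  hconv br (fun k => r.1 (N%:Z - k%:Z)) (fun k => s.1 (N%:Z - k%:Z))); last first.
  by apply/funext => k; rewrite PoszD; exact: lconvE.
rewrite [in RHS](_ : (fun k : nat => st.1 _) =
  hconv br (fun k => s.1 (N%:Z - k%:Z)) (fun k => t.1 (N%:Z - k%:Z))); last first.
  by apply/funext => k; rewrite PoszD; exact: lconvE.
rewrite addnA; apply: (@hconv_assoc _ g g g g g K^o kil br kil br) => //.
exact: killing_invariant.
Qed.

Lemma poly_embedding_lie (a b : vpoly g) :
  poly_embedding (poly_lie br a b) =
  dsum_lie (laurent_lie br) br (poly_embedding a) (poly_embedding b).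
Proof.
rewrite /poly_embedding /dsum_lie/= /dsum_lie_op/= peval_lie; congr (_, _).
have bb := lie_bilinear br.
have [N [aN bN]] := vpoly_bounded2 a b.
have B (c : vpoly g) : (forall k, (N <= k)%N -> c k = 0) ->
    bounded_by N%:Z (poly_laurent c).
  by move=> cN [k|]//; rewrite ltz_nat => /ltnW/cN.
apply: val_inj; apply/funext => k.
rewrite -[RHS]/(lconv br (poly_laurent a) (poly_laurent b) k) /lconv.
case: k => [k|k]; last first.
  rewrite fsbig1// => -[i|i] _ /=; last by rewrite (bilin0l bb).
  have -> : Negz k - i%:Z = Negz (k + i) by lia.
  by rewrite (bilin0r bb).
rewrite (fsbigE [seq (i%:Z : int) | i <- iota 0 k.+1])//.
- rewrite (eq_bigl xpredT); last by move=> i; rewrite in_setT.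
  rewrite big_map -[iota 0 _]/(index_iota 0 k.+1) big_mkord.
  apply: eq_bigr => -[i /= ik] _; congr (br _ _).
  by have -> : k%:Z - i%:Z = (k - i)%N%:Z by lia.
- by rewrite map_inj_uniq ?iota_uniq// => x y [].
- move=> [i|i] _ ir /=; last by rewrite (bilin0l bb).
  have ki : (k < i)%N.
    rewrite ltnNge; apply: contra ir => ik; apply: map_f.
    by rewrite mem_iota.
  have -> : k%:Z - i%:Z = Negz (i - k).-1 by lia.
  by rewrite (bilin0r bb).
Qed.

Lemma poly_laurent_linear : linear (@poly_laurent K g).
Proof.
move=> c a b; apply: val_inj; apply/funext => -[k|k].
  by [].
by transitivity (c *: (0 : g) + 0); rewrite // scaler0 addr0.
Qed.

Lemma poly_embedding_linear : linear (@poly_embedding K g).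
Proof.
by move=> c a b; rewrite /poly_embedding poly_laurent_linear peval_linear.
Qed.

Lemma Qform_poly N s (b : vpoly g) : (forall k, (N <= k)%N -> b k = 0) ->
  Qform br s (poly_embedding b) =
  \sum_(n < N) kil (s.1 (- n%:Z)) (b n) - kil s.2 (b 0%N).
Proof.
move=> bN; rewrite /Qform -[(poly_embedding b).2]/(peval b 0) peval0.
rewrite -[(poly_embedding b).1]/(poly_laurent b); congr (_ - _).
rewrite (fsbigE [seq - (n%:Z : int) | n <- iota 0 N])//.
- rewrite (eq_bigl xpredT); last by move=> i; rewrite in_setT.
  rewrite big_map -{1}[N]subn0 -/(index_iota 0 N) big_mkord.
  by apply: eq_bigr => i _; rewrite opprK.
- by rewrite map_inj_uniq ?iota_uniq// => x y /oppr_inj[].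
- move=> k _ kr.
  suff -> : poly_laurent b (- k) = 0 by exact: (bilin0r kb).
  case E : (- k) => [j|j] //=; apply: bN.
  rewrite leqNgt; apply: contra kr => jN.
  apply/mapP; exists j; first by rewrite mem_iota.
  by rewrite -E opprK.
Qed.

End FormQ.

(** * From a Manin triple to the classical double *)

Section DualTheory.
Context {K : fieldType} {V : lmodType K}.
Implicit Types l m : dual V.

Lemma dual_linear l : linear (l : V -> K^o).
Proof. by case: l => l /= /asboolP. Qed.

Lemma dual_eq l m : (forall x, l x = m x) -> l = m.
Proof. by move=> lm; apply: val_inj; apply/funext. Qed.

Lemma dualP c l m x : dual_fun (c *: l + m) x = c * l x + m x.
Proof. by []. Qed.

Lemma dual_sum l I (r : seq I) (P : pred I) (F : I -> V) :
  l (\sum_(i <- r | P i) F i) = \sum_(i <- r | P i) l (F i).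
Proof. exact: (lin_sum _ _ _ (dual_linear l)). Qed.

Definition mk_dual (f : V -> K^o) (lf : linear f) : dual V := Dual (asboolT lf).

Lemma tpair_bilinear_param (t : tensor V V) :
  is_bilinear (fun l m => tpair l m t : K^o).
Proof.
split=> [m|l] /=; apply: tlift_linear_param => x y c u v.
- by rewrite dualP mulrDl -mulrA.
- by rewrite dualP mulrDr mulrCA.
Qed.

Lemma lieBracket_eq (b b' : lieBracket V) : (forall x y, b x y = b' x y) -> b = b'.
Proof.
case: b => f fb fa fj; case: b' => f' fb' fa' fj' /= ff'.
have e : f = f' by apply/funext => x; apply/funext => y.
subst f'; congr LieBracket; exact: Prop_irrelevance.
Qed.

End DualTheory.

Section ManinTriple.
Context {K : fieldType} {V L : lmodType K}.
Context (brV : lieBracket V) (brL : lieBracket L).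
Context (delta : V -> tensor V V) (Q : L -> L -> K).
Context (iota : V -> L) (psi : dual V -> L).

Hypothesis delta_linear : linear delta.
Hypothesis Q_invariant : forall r s t, Q (brL r s) t = Q r (brL s t).
Hypothesis iota_linear : linear iota.
Hypothesis psi_linear : linear psi.
Hypothesis iota_lie : forall x y, iota (brV x y) = brL (iota x) (iota y).

Definition cobracket_dual (l m : dual V) : dual V :=
  mk_dual (linear_comp (tpair_linear (dual_linear l) (dual_linear m)) delta_linear).

Lemma cobracket_dualP : is_dual_bracket delta cobracket_dual.
Proof. by []. Qed.

(* psi is a morphism for the bracket dual to delta: the Lie axioms of that
   bracket are consequences, not assumptions. *)
Hypothesis psi_lie :
  forall l m, psi (cobracket_dual l m) = brL (psi l) (psi m).

Definition triple_map (s : V * dual V) : L := iota s.1 + psi s.2.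

Hypothesis triple_form :
  forall s t, Q (triple_map s) (triple_map t) = double_form s t.

Context (inv : L -> V * dual V).
Hypothesis triple_mapK : cancel triple_map inv.
Hypothesis invK : cancel inv triple_map.
Hypothesis dual_separates : forall x : V, (forall l : dual V, l x = 0) -> x = 0.

Lemma triple_map_linear : linear triple_map.
Proof.
by move=> c s t; rewrite /triple_map /= iota_linear psi_linear scalerDr addrACA.
Qed.

Lemma triple_map_inj : injective triple_map.
Proof. exact: can_inj triple_mapK. Qed.

Lemma psi_inj : injective psi.
Proof.
move=> l m lm.
suff [//] : (0, l) = (0, m) :> V * dual V.
by apply: triple_map_inj; rewrite /triple_map/= lm.
Qed.

Lemma cobracket_dual_bilinear : is_bilinear cobracket_dual.
Proof.
split=> [m c l l'|l c m m']; apply: dual_eq => x.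
- by rewrite dualP; exact: (tpair_bilinear_param (delta x)).1.
- by rewrite dualP; exact: (tpair_bilinear_param (delta x)).2.
Qed.

Lemma cobracket_dual_alt l : cobracket_dual l l = 0.
Proof. by apply: psi_inj; rewrite psi_lie lie_alt lin0. Qed.

Lemma cobracket_dual_jacobi l m n :
  cobracket_dual l (cobracket_dual m n) +
  cobracket_dual m (cobracket_dual n l) +
  cobracket_dual n (cobracket_dual l m) = 0.
Proof.
by apply: psi_inj; rewrite !(linD _ _ psi_linear) !psi_lie lie_jacobi lin0.
Qed.

Definition dual_lie : lieBracket (dual V) :=
  LieBracket cobracket_dual_bilinear cobracket_dual_alt cobracket_dual_jacobi.

Definition double_op (s t : V * dual V) := inv (brL (triple_map s) (triple_map t)).

Lemma triple_map_double s t :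
  triple_map (double_op s t) = brL (triple_map s) (triple_map t).
Proof. exact: invK. Qed.

Lemma double_bilinear : is_bilinear double_op.
Proof.
have b := lie_bilinear brL.
split=> [t c s s'|s c t t']; apply: triple_map_inj; rewrite /=;
  rewrite triple_map_linear !triple_map_double triple_map_linear.
- by rewrite (bilinDl b) (bilinZl b).
- by rewrite (bilinDr b) (bilinZr b).
Qed.

Lemma double_alt s : double_op s s = 0.
Proof.
apply: triple_map_inj.
by rewrite triple_map_double lie_alt (lin0 triple_map_linear).
Qed.

Lemma double_jacobi r s t :
  double_op r (double_op s t) + double_op s (double_op t r) +
  double_op t (double_op r s) = 0.
Proof.
apply: triple_map_inj; rewrite !(linD _ _ triple_map_linear) !triple_map_double.
by rewrite lie_jacobi (lin0 triple_map_linear).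
Qed.

Definition double_lie : lieBracket (V * dual V)%type :=
  LieBracket double_bilinear double_alt double_jacobi.

Lemma triple_map1 x : triple_map (x, 0) = iota x.
Proof. by rewrite /triple_map/= (lin0 psi_linear) addr0. Qed.

Lemma triple_map2 l : triple_map (0, l) = psi l.
Proof. by rewrite /triple_map/= (lin0 iota_linear) add0r. Qed.

Lemma double_lie_classical : is_classical_double brV delta double_lie.
Proof.
split=> [x y||r s t].
- by apply: triple_map_inj; rewrite triple_map_double !triple_map1 iota_lie.
- exists cobracket_dual; first exact: cobracket_dualP.
  by move=> l m; apply: triple_map_inj; rewrite triple_map_double !triple_map2.
- by rewrite -!triple_form !triple_map_double Q_invariant.
Qed.

Lemma double_formE x y (l m : dual V) : double_form (x, l) (y, m) = l y + m x.
Proof. by []. Qed.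

Lemma double_formC (s t : V * dual V) : double_form s t = double_form t s.
Proof. by rewrite /double_form addrC. Qed.

Lemma double_form_linearl (t : V * dual V) :
  linear (fun s => double_form s t : K^o).
Proof.
case: t => y m c [x l] [x' l'].
rewrite (_ : c *: (x, l) + (x', l') = (c *: x + x', c *: l + l'))//.
rewrite !double_formE dualP (dual_linear m).
by rewrite scalerDr addrACA.
Qed.

Lemma double_form_nondeg (s : V * dual V) :
  (forall t, double_form s t = 0) -> s = 0.
Proof.
case: s => x l s0; congr (_, _).
  apply: dual_separates => m; have := s0 (0, m).
  by rewrite /double_form/= (lin0 (dual_linear l)) add0r.
apply: dual_eq => y; have := s0 (y, 0).
by rewrite /double_form/= addr0.
Qed.

(** For an invariant form, (r, s, t) |-> ([r, s], t) is cyclic.  Among three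
elements of V or V^*, two are of the same kind, and any two of three are
cyclically consecutive; so the form, hence the bracket, is determined by the
brackets inside V and inside V^*. *)
Lemma classical_double_unique (D D' : lieBracket (V * dual V)%type) :
  is_classical_double brV delta D -> is_classical_double brV delta D' -> D = D'.
Proof.
move=> [DV [B BP DB] Dinv] [D'V [B' BP' DB'] D'inv].
have BB' l m : B l m = B' l m by apply: dual_eq => x; rewrite BP BP'.
have b := lie_bilinear D; have b' := lie_bilinear D'.
pose inV (s : V * dual V) := s = (s.1, 0).
pose inD (s : V * dual V) := s = (0, s.2).
have VV s t : inV s -> inV t -> D s t = D' s t by move=> -> ->; rewrite DV D'V.
have DD s t : inD s -> inD t -> D s t = D' s t by move=> -> ->; rewrite DB DB' BB'.
have cyc r s t : double_form (D r s) t = double_form (D s t) r.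
  by rewrite Dinv double_formC.
have cyc' r s t : double_form (D' r s) t = double_form (D' s t) r.
  by rewrite D'inv double_formC.
have pure r s t : inV r \/ inD r -> inV s \/ inD s -> inV t \/ inD t ->
    double_form (D r s) t = double_form (D' r s) t.
  case=> rp; case=> sp; case=> tp.
  - by rewrite VV.
  - by rewrite VV.
  - by rewrite -cyc -cyc' VV.
  - by rewrite cyc cyc' DD.
  - by rewrite cyc cyc' VV.
  - by rewrite -cyc -cyc' DD.
  - by rewrite DD.
  - by rewrite DD.
have formDr (u v w : V * dual V) : double_form u (v + w) = double_form u v + double_form u w.
  by rewrite double_formC (linD _ _ (double_form_linearl u)) !(double_formC u).
have formDl (u v w : V * dual V) : double_form (v + w) u = double_form v u + double_form w u.
  exact: (linD _ _ (double_form_linearl u)).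
have split (s : V * dual V) : exists s1 s2,
    [/\ s = s1 + s2, inV s1 \/ inD s1 & inV s2 \/ inD s2].
  exists (s.1, 0), (0, s.2); split; [|by left|by right].
  by case: s => x l; congr (_, _); rewrite /= ?addr0 ?add0r.
have pure2 r s t : inV r \/ inD r -> inV s \/ inD s ->
    double_form (D r s) t = double_form (D' r s) t.
  by move=> rp sp; have [t1 [t2 [-> tp1 tp2]]] := split t; rewrite !formDr !pure.
have pure1 r s t : inV r \/ inD r ->
    double_form (D r s) t = double_form (D' r s) t.
  move=> rp; have [s1 [s2 [-> sp1 sp2]]] := split s.
  by rewrite (bilinDr b) (bilinDr b') !formDl !pure2.
apply: lieBracket_eq => r s; apply/eqP; rewrite -subr_eq0; apply/eqP.
apply: double_form_nondeg => t.
rewrite formDl -scaleN1r (linZ _ _ (double_form_linearl t)) scaleN1r.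
apply/eqP; rewrite subr_eq0; apply/eqP.
have [r1 [r2 [-> rp1 rp2]]] := split r.
by rewrite (bilinDl b) (bilinDl b') !formDl !pure1.
Qed.

Theorem manin_triple_classical_double :
  (exists B : lieBracket (dual V), is_dual_bracket delta B) /\
  exists D : lieBracket (V * dual V)%type,
    unique (is_classical_double brV delta) D /\
    exists phi : {linear (V * dual V)%type -> L},
      [/\ bijective phi, forall s t, phi (D s t) = brL (phi s) (phi t),
          forall x, phi (x, 0) = iota x
        & forall s t, Q (phi s) (phi t) = double_form s t].
Proof.
split; first by exists dual_lie; exact: cobracket_dualP.
exists double_lie; split.
  split; first exact: double_lie_classical.
  by move=> D'; apply: classical_double_unique; exact: double_lie_classical.
pose phi : {linear (V * dual V)%type -> L} := HB.pack triple_map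
  (GRing.isLinear.Build K (V * dual V)%type L *:%R triple_map triple_map_linear).
exists phi; split.
- by exists inv.
- exact: triple_map_double.
- exact: triple_map1.
- exact: triple_form.
Qed.

End ManinTriple.

(** * Contracting the classical Yang-Baxter equation *)

Section Contraction.
Context {K : fieldType}.
Implicit Types V W : lmodType K.

Definition contract1 V W (c : V -> K^o) (t : tensor V W) : W :=
  tlift (fun x y => (c x : K) *: y) t.

Definition contract2 V W (l : W -> K^o) (t : tensor V W) : V :=
  tlift (fun x y => (l y : K) *: x) t.

Lemma contract1_linear V W c : linear c -> linear (@contract1 V W c).
Proof. by move=> lc; apply: tlift_linear; exact: bilinear_scale. Qed.

Lemma contract1_tens V W c x y : linear c ->
  @contract1 V W c (tens x y) = (c x : K) *: y.
Proof. by move=> lc; apply: tlift_tens; exact: bilinear_scale. Qed.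

Lemma contract2_linear V W l : linear l -> linear (@contract2 V W l).
Proof.
move=> ll; apply: tlift_linear.
by apply: bilinear_flip; exact: bilinear_scale.
Qed.

Lemma contract2_tens V W l x y : linear l ->
  @contract2 V W l (tens x y) = (l y : K) *: x.
Proof.
move=> ll; apply: tlift_tens; by apply: bilinear_flip; exact: bilinear_scale.
Qed.

Lemma contract2_tpair V (l m : V -> K^o) t : linear l -> linear m ->
  l (contract2 m t) = tpair l m t.
Proof.
move=> ll lm; move: t.
apply: tensor_ext => [||x y].
- by apply: linear_comp => //; exact: contract2_linear.
- exact: tpair_linear.
- by rewrite contract2_tens// linZ// tpair_tens// [LHS]mulrC.
Qed.

Lemma tpair_tflip V (l m : V -> K^o) t : linear l -> linear m ->
  tpair l m (tflip t) = tpair m l t.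
Proof.
move=> ll lm; move: t; apply: (@tensor_ext _ _ _ K^o) => [||x y].
- by apply: linear_comp; [exact: tpair_linear|exact: tflip_linear].
- exact: tpair_linear.
- by rewrite tflip_tens !tpair_tens// mulrC.
Qed.

End Contraction.

Section YangBaxterContraction.
Context {K : fieldType} {g : lmodType K} (br : lieBracket g) (c : g -> K^o).
Hypothesis lc : linear c.
Implicit Types W : lmodType K.
Let bb := lie_bilinear br.

(** The contraction by c of the first factor of [s^12, t^13].  Allowing s and t in
g (x) W covers both the values of X and its coefficients in u. *)
Definition bracket_contract W (s t : tensor g W) : tensor W W :=
  tlift2 (fun x y x' y' => (c (br x x') : K) *: tens y y') s t.

Lemma bracket_contract_quadrilinear W :
  quadrilinear (fun (x : g) (y : W) (x' : g) (y' : W) =>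
    (c (br x x') : K) *: tens y y').
Proof.
have tb := @tens_bilinear K W W.
split=> [x' y'|x y].
- apply: (bilinear_comp (h := fun (a : K^o) (z : tensor W W) => (a : K) *: z)
    (F := fun x => c (br x x')) (G := fun y => tens y y')).
  + exact: (@bilinear_scale _ K^o _ id).
  + by apply: (linear_comp lc); exact: (bb.1 x').
  + exact: (tb.1 y').
- apply: (bilinear_comp (h := fun (a : K^o) (z : tensor W W) => (a : K) *: z)
    (F := fun x' => c (br x x')) (G := fun y' => tens y y')).
  + exact: (@bilinear_scale _ K^o _ id).
  + by apply: (linear_comp lc); exact: (bb.2 x).
  + exact: (tb.2 y).
Qed.

Lemma bracket_contract_bilinear W : is_bilinear (@bracket_contract W).
Proof. exact: tlift2_bilinear (bracket_contract_quadrilinear W). Qed.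

Lemma bracket_contract_tens W x (y : W) x' y' :
  bracket_contract (tens x y) (tens x' y') = (c (br x x') : K) *: tens y y'.
Proof. exact: tlift2_tens (bracket_contract_quadrilinear W). Qed.

Let contract3 : tensor (tensor g g) g -> tensor g g := hmap (contract1 c) id.

Let lc1 := @contract1_linear _ g g c lc.

Lemma contract3_linear : linear contract3.
Proof. exact: hmap_linear. Qed.

Lemma contract3_tens x y z : contract3 (tens (tens x y) z) = (c x : K) *: tens y z.
Proof.
rewrite /contract3 hmap_tens// contract1_tens//.
by rewrite (bilinZl (@tens_bilinear _ _ _)).
Qed.

Lemma contract3_br12_13 s t : contract3 (br12_13 br s t) = bracket_contract s t.
Proof.
have tb := @tens_bilinear K g g; have tb3 := @tens_bilinear K (tensor g g) g.
pose h := fun x y x' y' : g => tens (tens (br x x') y) y'.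
have q : quadrilinear h.
  split=> [x' y'|x y].
    by split=> [z a u v|z a u v]; rewrite /h /=;
      rewrite ?(bilinDl bb, bilinZl bb) ?(bilinDl tb, bilinZl tb)
        ?(bilinDr tb, bilinZr tb) ?(bilinDl tb3, bilinZl tb3).
  by split=> [z a u v|z a u v]; rewrite /h /=;
      rewrite ?(bilinDr bb, bilinZr bb) ?(bilinDl tb, bilinZl tb)
        ?(bilinDl tb3, bilinZl tb3) ?(bilinDr tb3, bilinZr tb3).
rewrite -[br12_13 br s t]/(tlift2 h s t); move: s t.
apply: bilinear_tensor_ext.
- by apply: comp_bilinear; [exact: tlift2_bilinear q|exact: contract3_linear].
- exact: bracket_contract_bilinear.
- by move=> x y x' y'; rewrite tlift2_tens// contract3_tens bracket_contract_tens.
Qed.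

Lemma contract_tbr_bilinear :
  is_bilinear (fun s r => tbr br r (contract1 c s) 0) *
  is_bilinear (fun s r => tbr br r 0 (contract1 c s)).
Proof.
split; split=> [r a s s'|s a r r'] /=.
- by rewrite lc1 -[X in tbr br r _ X](addr0 0) -{1}(scaler0 _ a) tbrD tbrZ.
- exact: tbr_linear.
- by rewrite lc1 -[X in tbr br r X _](addr0 0) -{1}(scaler0 _ a) tbrD tbrZ.
- exact: tbr_linear.
Qed.

Lemma contract3_br12_23 s r :
  contract3 (br12_23 br s r) = - tbr br r (contract1 c s) 0.
Proof.
have tb := @tens_bilinear K g g; have tb3 := @tens_bilinear K (tensor g g) g.
pose h := fun x y x' y' : g => tens (tens x (br y x')) y'.
have q : quadrilinear h.
  split=> [x' y'|x y].
    by split=> [z a u v|z a u v]; rewrite /h /=;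
      rewrite ?(bilinDl bb, bilinZl bb) ?(bilinDl tb, bilinZl tb)
        ?(bilinDr tb, bilinZr tb) ?(bilinDl tb3, bilinZl tb3).
  by split=> [z a u v|z a u v]; rewrite /h /=;
      rewrite ?(bilinDr bb, bilinZr bb) ?(bilinDr tb, bilinZr tb)
        ?(bilinDl tb3, bilinZl tb3) ?(bilinDr tb3, bilinZr tb3).
rewrite -[br12_23 br s r]/(tlift2 h s r); move: s r.
apply: bilinear_tensor_ext.
- by apply: comp_bilinear; [exact: tlift2_bilinear q|exact: contract3_linear].
- have [hb _] := contract_tbr_bilinear.
  by apply: (comp_bilinear hb) => a u v; rewrite opprD scalerN.
- move=> x y x' y'; rewrite tlift2_tens// contract3_tens contract1_tens// tbr_tens.
  rewrite (bilin0r bb) (bilin0r tb) addr0 (bilinZr bb) (bilinZl tb).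
  by rewrite lie_anti -scaleN1r (bilinZl tb) scaleN1r scalerN.
Qed.

Lemma contract3_br13_23 s r :
  contract3 (br13_23 br s r) = - tbr br r 0 (contract1 c s).
Proof.
have tb := @tens_bilinear K g g; have tb3 := @tens_bilinear K (tensor g g) g.
pose h := fun x y x' y' : g => tens (tens x x') (br y y').
have q : quadrilinear h.
  split=> [x' y'|x y].
    by split=> [z a u v|z a u v]; rewrite /h /=;
      rewrite ?(bilinDl bb, bilinZl bb) ?(bilinDl tb, bilinZl tb)
        ?(bilinDr tb3, bilinZr tb3) ?(bilinDl tb3, bilinZl tb3).
  by split=> [z a u v|z a u v]; rewrite /h /=;
      rewrite ?(bilinDr bb, bilinZr bb) ?(bilinDr tb, bilinZr tb)
        ?(bilinDl tb3, bilinZl tb3) ?(bilinDr tb3, bilinZr tb3).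
rewrite -[br13_23 br s r]/(tlift2 h s r); move: s r.
apply: bilinear_tensor_ext.
- by apply: comp_bilinear; [exact: tlift2_bilinear q|exact: contract3_linear].
- have [_ hb] := contract_tbr_bilinear.
  by apply: (comp_bilinear hb) => a u v; rewrite opprD scalerN.
- move=> x y x' y'; rewrite tlift2_tens// contract3_tens contract1_tens// tbr_tens.
  rewrite (bilin0r bb) (bilin0l tb) add0r (bilinZr bb) (bilinZr tb).
  by rewrite lie_anti -scaleN1r (bilinZr tb) scaleN1r scalerN.
Qed.

(** For s = X(u, v), t = X(u, w) and r = X(v, w): the right-hand side is
[r, a (x) 1 + 1 (x) b] with a and b the values at v and w of one and the same
function, hence a value of the cobracket once u is eliminated. *)
Lemma contracted_CYBE s t r :
  br12_13 br s t + br12_23 br s r + br13_23 br t r = 0 ->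
  bracket_contract s t =
  tbr br r (contract1 c s) 0 + tbr br r 0 (contract1 c t).
Proof.
move=> /(congr1 contract3); rewrite !(linD _ _ contract3_linear).
rewrite (lin0 contract3_linear) contract3_br12_13 contract3_br12_23.
rewrite contract3_br13_23 -addrA -opprD => /eqP.
by rewrite subr_eq0 => /eqP.
Qed.

Lemma tpair_bracket_contract W (l m : W -> K^o) s t : linear l -> linear m ->
  tpair l m (bracket_contract s t) = c (br (contract2 l s) (contract2 m t)).
Proof.
move=> ll lm; move: s t; apply: (@bilinear_tensor_ext _ g W g W K^o
  (fun s t => tpair l m (bracket_contract s t))
  (fun s t => c (br (contract2 l s) (contract2 m t)))).
- by apply: comp_bilinear; [exact: bracket_contract_bilinear|exact: tpair_linear].
- by apply: (comp_bilinear (bilinear_comp bb _ _) lc); exact: contract2_linear.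
- move=> x y x' y'; rewrite bracket_contract_tens (linZ _ _ (tpair_linear ll lm)).
  rewrite tpair_tens// !contract2_tens// (bilinZl bb) (bilinZr bb) !(linZ _ _ lc).
  by rewrite [LHS]mulrC -mulrA.
Qed.

End YangBaxterContraction.

(** * The cobracket of a quasi-trigonometric solution *)

Section Cobracket.
Context {K : numFieldType} {g : vectType K} (br : lieBracket g).
Context (X : K -> K -> tensor g g).

Lemma eval2_tbr u v t (a b : vpoly g) :
  eval2 u v (tbr (poly_lie br) t a b) =
  tbr br (eval2 u v t) (peval a u) (peval b v).
Proof.
move: t; apply: tensor_ext => [||x y].
- by apply: linear_comp; [exact: eval2_linear|exact: tbr_linear].
- by apply: linear_comp; [exact: tbr_linear|exact: eval2_linear].
- rewrite tbr_tens (linD _ _ (eval2_linear u v)) !eval2_tens tbr_tens.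
  by rewrite !peval_lie.
Qed.

Lemma eval2_tflip u v (t : tensor (vpoly g) (vpoly g)) :
  eval2 u v (tflip t) = tflip (eval2 v u t).
Proof. by apply: tmap_tflip; exact: peval_linear. Qed.

(** From here on p is an element of g[u] (x) g[v]. *)
Lemma peval2_polynomial (p : vpoly (vpoly (tensor g g))) :
  exists phat : tensor (vpoly g) (vpoly g),
    forall u v, u != v -> eval2 u v phat = peval2 p u v.
Proof.
have [N pN] := vpoly_bounded p.
suff [d dP] : polynomial_off_diagonal
    (fun u v => \sum_(j < N) v ^+ j *: peval (p j) u).
  exists d => u v uv; rewrite dP// /peval2 (pevalE _ pN).
  rewrite (lin_sum _ _ _ (peval_linear u)); apply: eq_bigr => j _.
  by rewrite (linZ _ _ (peval_linear u)).
apply: off_diagonal_sum => j; have [M pM] := vpoly_bounded (p j).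
apply: (@off_diagonal_eq _ _ (fun u v => \sum_(i < M) (u ^+ i * v ^+ j) *: p j i)).
  move=> u v _; rewrite (pevalE _ pM) scaler_sumr; apply: eq_bigr => i _.
  by rewrite scalerA mulrC.
by apply: off_diagonal_sum => i; exact: off_diagonal_mono.
Qed.

Context (Omega : tensor g g) (phat : tensor (vpoly g) (vpoly g)).
Hypothesis cas : is_casimir br Omega.
Hypothesis XE : forall u v, u != v ->
  X u v = (v / (u - v)) *: Omega + eval2 u v phat.

(** By invariance of Omega its bracket with a(u) (x) 1 + 1 (x) a(v) only depends on
a(u) - a(v), which is divisible by u - v. *)
Lemma cobracket_polynomial a :
  polynomial_off_diagonal (fun u v => tbr br (X u v) (peval a u) (peval a v)).
Proof.
have [N aN] := vpoly_bounded a.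
apply: (@off_diagonal_eq _ _ (fun u v =>
  \sum_(n < N) \sum_(i < n) (u ^+ (n.-1 - i) * v ^+ i.+1) *: tbr br Omega (a n) 0
  + eval2 u v (tbr (poly_lie br) phat a a))); last first.
  apply: off_diagonal_add; last by exists (tbr (poly_lie br) phat a a).
  by do 2 apply: off_diagonal_sum => ?; exact: off_diagonal_mono.
move=> u v uv; rewrite eval2_tbr XE// (linD _ _ (tbr_linear br _ _)).
rewrite (linZ _ _ (tbr_linear br _ _)); congr (_ + _).
have -> : tbr br Omega (peval a u) (peval a v) =
    tbr br Omega (peval a u - peval a v) 0.
  have := tbrD br Omega (peval a u - peval a v) 0 (peval a v) (peval a v).
  by rewrite subrK add0r (casimir_invariant cas) addr0.
have -> : peval a u - peval a v = \sum_(n < N) (u ^+ n - v ^+ n) *: a n.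
  by rewrite !(pevalE _ aN) -sumrB; apply: eq_bigr => n _; rewrite scalerBl.
have lin1 : linear (fun x => tbr br Omega x 0).
  move=> c x y; rewrite -tbrZ -tbrD scaler0 addr0; congr (tbr br _ _ _).
rewrite (lin_sum _ _ _ lin1) scaler_sumr; apply: eq_bigr => n _.
rewrite (linZ _ _ lin1) scalerA subrXX -scaler_suml; congr (_ *: _).
rewrite mulrA divfK ?subr_eq0// mulr_sumr; apply: eq_bigr => i _.
by rewrite exprS mulrCA.
Qed.

Lemma cobracket_exists : exists delta, is_cobracket_of br X delta.
Proof.
have [delta dP] := choice cobracket_polynomial.
by exists delta => a u v uv; exact: dP.
Qed.

End Cobracket.

(** * The Manin triple of a quasi-trigonometric solution *)

Section Solution.
Context {K : numFieldType} {g : vectType K} (br : lieBracket g).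
Context (X : K -> K -> tensor g g).
Context (Omega : tensor g g) (phat : tensor (vpoly g) (vpoly g)).
Hypothesis cas : is_casimir br Omega.
Hypothesis XE : forall u v, u != v ->
  X u v = (v / (u - v)) *: Omega + eval2 u v phat.
Hypothesis cybe : CYBE br X.
Context (delta : vpoly g -> tensor (vpoly g) (vpoly g)).
Hypothesis deltaP : is_cobracket_of br X delta.
Local Notation V := (vpoly g).
Local Notation kil := (killing br : g -> g -> K^o).
Let kb := killing_bilinear br.

Lemma delta_eval a u v : u != v ->
  eval2 u v (delta a) = tbr br (X u v) (peval a u) (peval a v).
Proof. exact: deltaP. Qed.

Lemma cobracket_unique : unique (is_cobracket_of br X) delta.
Proof.
split=> // delta' dP'; apply/funext => a.
apply: (@eval2_inj _ _ [::]) => u v _ _ uv.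
by rewrite delta_eval//; apply/esym; exact: dP'.
Qed.

Lemma delta_linear : linear delta.
Proof.
move=> c a b; apply: (@eval2_inj _ _ [::]) => u v _ _ uv.
by rewrite (eval2_linear u v) !delta_eval// !peval_linear tbrD tbrZ.
Qed.

Lemma delta_cocycle x y : delta (poly_lie br x y) =
  tbr (poly_lie br) (delta x) y y - tbr (poly_lie br) (delta y) x x.
Proof.
apply: (@eval2_inj _ _ [::]) => u v _ _ uv.
rewrite (linB _ _ (eval2_linear u v)) !eval2_tbr !delta_eval// !peval_lie.
exact: tbr_lie.
Qed.

Definition nonneg_coef (n : nat) : tensor g V :=
  hmap (fun a : V => a n) id phat.

Definition casimir_coef (n : nat) : tensor g V := hmap id (mono n) Omega.

(** The coefficient X_n(v) of u^n in the expansion of X(u, v) for |u| > |v|. *)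
Definition Xcoef (n : int) : tensor g V :=
  match n with Posz i => nonneg_coef i | Negz i => casimir_coef i.+1 end.

Definition eval_right (v : K) : tensor g V -> tensor g g := hmap id (peval^~ v).

Lemma eval_right_linear v : linear (eval_right v).
Proof. by apply: hmap_linear => //; exact: peval_linear. Qed.

Lemma eval_right_tens v x a : eval_right v (tens x a) = tens x (peval a v).
Proof. by apply: hmap_tens => //; exact: peval_linear. Qed.

Lemma casimir_coef_eval v n : eval_right v (casimir_coef n) = v ^+ n *: Omega.
Proof.
rewrite /casimir_coef; move: Omega; apply: tensor_ext => [||x y].
- apply: linear_comp; first exact: eval_right_linear.
  by apply: hmap_linear => //; exact: mono_linear.
- by apply: linear_scale.
- rewrite hmap_tens//; last exact: mono_linear.
  by rewrite eval_right_tens peval_mono (bilinZr (@tens_bilinear _ _ _)).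
Qed.

Lemma Xcoef_eval v n : eval_right v (Xcoef n) =
  polar_coef (fun i => eval_right v (nonneg_coef i)) Omega v n.
Proof. by case: n => // n; exact: casimir_coef_eval. Qed.

Lemma nonneg_coef_eq0 N :
  (forall p, p \in repr phat -> forall k, (N <= k)%N -> p.1 k = 0) ->
  forall n, (N <= n)%N -> nonneg_coef n = 0.
Proof.
move=> pN n Nn; rewrite /nonneg_coef [phat]tensor_sum lin_sum; last first.
  exact: hmap_linear.
rewrite big_seq big1// => p /pN p1; rewrite hmap_tens// p1//.
exact: (bilin0l (@tens_bilinear _ _ _)).
Qed.

Lemma nonneg_coef_bounded : exists N, forall n, (N < n)%N -> nonneg_coef n = 0.
Proof.
have [N pN] := tensor2_bounded phat; exists N => n /ltnW.
by apply: nonneg_coef_eq0 => p /pN[].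
Qed.

Lemma eval2_nonneg_coef N u v : (forall n, (N < n)%N -> nonneg_coef n = 0) ->
  eval2 u v phat = \sum_(i < N.+1) u ^+ i *: eval_right v (nonneg_coef i).
Proof.
move=> cN; have [M pM] := tensor2_bounded phat.
have E : eval2 u v phat = \sum_(i < M) u ^+ i *: eval_right v (nonneg_coef i).
  rewrite {1}[phat]tensor_sum (lin_sum _ _ _ (eval2_linear u v)).
  under [RHS]eq_bigr => i _.
    rewrite /nonneg_coef [phat in hmap _ _ phat]tensor_sum.
    rewrite (lin_sum _ _ _ (hmap_linear (coef_linear i) _))//.
    rewrite (lin_sum _ _ _ (eval_right_linear v)) scaler_sumr.
    over.
  rewrite exchange_big/= !big_seq; apply: eq_bigr => p /pM[p1 _].
  rewrite eval2_tens (pevalE _ p1) (bilin_suml (@tens_bilinear _ _ _)).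
  apply: eq_bigr => i _; rewrite hmap_tens// eval_right_tens.
  by rewrite (bilinZl (@tens_bilinear _ _ _)).
have ev0 n : nonneg_coef n = 0 -> eval_right v (nonneg_coef n) = 0.
  by move=> ->; exact: lin0 (eval_right_linear v).
have FN n : (N.+1 <= n)%N -> eval_right v (nonneg_coef n) = 0.
  by move=> Nn; apply: ev0; exact: cN.
have FM n : (M <= n)%N -> eval_right v (nonneg_coef n) = 0.
  by move=> Mn; apply: ev0; apply: nonneg_coef_eq0 Mn => p /pM[].
by rewrite E -(eval_widen u (leq_maxl M N.+1) FM) (eval_widen u (leq_maxr M _) FN).
Qed.

Lemma X_polar N u v : (forall n, (N < n)%N -> nonneg_coef n = 0) -> u != v ->
  X u v = polar_eval N (fun i => eval_right v (nonneg_coef i)) Omega v u.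
Proof. by move=> cN uv; rewrite XE// /polar_eval -(eval2_nonneg_coef _ _ cN) addrC. Qed.

Section Contracted.
Context (c : g -> K^o).
Hypothesis lc : linear c.

Lemma eval2_bracket_contract v w (s t : tensor g V) :
  eval2 v w (bracket_contract br c s t) =
  bracket_contract br c (eval_right v s) (eval_right w t).
Proof.
move: s t; apply: bilinear_tensor_ext.
- by apply: comp_bilinear; [exact: bracket_contract_bilinear|exact: eval2_linear].
- apply: bilinear_comp; [exact: bracket_contract_bilinear|
    exact: eval_right_linear|exact: eval_right_linear].
- move=> x a x' b; rewrite !eval_right_tens !bracket_contract_tens//.
  by rewrite (linZ _ _ (eval2_linear v w)) eval2_tens.
Qed.

Lemma contract1_eval_right v (s : tensor g V) :
  contract1 c (eval_right v s) = peval (contract1 c s) v.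
Proof.
move: s; apply: tensor_ext => [||x a].
- by apply: linear_comp; [exact: contract1_linear|exact: eval_right_linear].
- by apply: (linear_comp (peval_linear v)); exact: contract1_linear.
- by rewrite eval_right_tens !contract1_tens// (linZ _ _ (peval_linear v)).
Qed.

Lemma X_contracted u v w : u != v -> u != w -> v != w ->
  bracket_contract br c (X u v) (X u w) =
  tbr br (X v w) (contract1 c (X u v)) 0 + tbr br (X v w) 0 (contract1 c (X u w)).
Proof. by move=> uv uw vw; apply: contracted_CYBE => //; exact: cybe.1. Qed.

(** The coefficient of u^(2N - k) in the contracted Yang-Baxter equation at fixed
v and w, which determines it as an element of g[v] (x) g[w]. *)
Lemma Xcoef_bracket N k : (forall n, (N < n)%N -> nonneg_coef n = 0) ->
  hconv (@bracket_contract _ _ br c V) (fun i => Xcoef (N%:Z - i%:Z))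
    (fun i => Xcoef (N%:Z - i%:Z)) k =
  delta (contract1 c (Xcoef (N%:Z + N%:Z - k%:Z))).
Proof.
move=> cN; apply: (@eval2_inj _ _ [::]) => v w _ _ vw.
rewrite delta_eval// -!contract1_eval_right /hconv.
rewrite (lin_sum _ _ _ (eval2_linear v w)).
under eq_bigr do rewrite eval2_bracket_contract !Xcoef_eval.
rewrite -[contract1 c (eval_right v _)]addr0 -[contract1 c (eval_right w _)]add0r.
rewrite tbrD !Xcoef_eval.
have lin1 : linear (fun s => tbr br (X v w) (contract1 c s) 0).
  exact: ((contract_tbr_bilinear br lc).1.1 (X v w)).
have lin2 : linear (fun s => tbr br (X v w) 0 (contract1 c s)).
  exact: ((contract_tbr_bilinear br lc).2.1 (X v w)).
have F0 z n : (N < n)%N -> eval_right z (nonneg_coef n) = 0.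
  by move=> /cN ->; exact: lin0 (eval_right_linear z).
have := @polar_identity _ _ _ _ _ _ _ N _ _ Omega Omega v w [:: v; w]
  (bracket_contract_bilinear br lc g) lin1 lin2 (F0 v) (F0 w).
apply=> u; rewrite !inE negb_or => /andP[uv uw].
by rewrite -!X_polar// X_contracted.
Qed.

(** The function X(0, v) = p(0, v) - Omega, from which the component in g of psi is
built; it is not the free term of the expansion at u = infinity. *)
Definition X_at_0 : tensor g V := Xcoef 0 - casimir_coef 0.

Lemma eval_right_X_at_0 v : v != 0 -> eval_right v X_at_0 = X 0 v.
Proof.
move=> v0; rewrite /X_at_0 (linB _ _ (eval_right_linear v)) casimir_coef_eval.
have [N cN] := nonneg_coef_bounded.
rewrite XE 1?eq_sym// (eval2_nonneg_coef _ _ cN) big_ord_recl big1 ?addr0.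
  by rewrite !expr0 !scale1r sub0r invrN mulrN divff// scaleN1r addrC.
by move=> i _; rewrite expr0n scale0r.
Qed.

(** The contracted Yang-Baxter equation at the points 0, v, w. *)
Lemma X_at_0_bracket :
  bracket_contract br c X_at_0 X_at_0 = delta (contract1 c X_at_0).
Proof.
apply: (@eval2_inj _ _ [:: 0]) => v w; rewrite !inE => v0 w0 vw.
rewrite delta_eval// -!contract1_eval_right eval2_bracket_contract.
rewrite !eval_right_X_at_0// X_contracted 1?eq_sym//; last by rewrite eq_sym.
by rewrite -tbrD addr0 add0r.
Qed.

End Contracted.

Lemma psi_subproof (l : dual V) : (fun n => contract2 l (Xcoef n)) \in bdd_degree.
Proof.
have [N cN] := nonneg_coef_bounded; apply/asboolP; exists N%:Z => -[n|n]//.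
rewrite ltz_nat => /cN /= ->.
exact: lin0 (contract2_linear (dual_linear l)).
Qed.

Definition psi (l : dual V) : vlaurent g * g :=
  (VLaurent (psi_subproof l), contract2 l X_at_0).

Lemma contract2_linear_param (t : tensor g V) :
  linear (fun l : dual V => contract2 l t).
Proof.
by apply: tlift_linear_param => x a c l m; rewrite dualP scalerDl scalerA.
Qed.

Lemma psi_linear : linear psi.
Proof.
move=> c l m; rewrite /psi contract2_linear_param.
congr (_, _); apply: val_inj; apply/funext => n.
exact: contract2_linear_param.
Qed.

Lemma contract12 (c : g -> K^o) (l : dual V) (t : tensor g V) : linear c ->
  c (contract2 l t) = l (contract1 c t).
Proof.
move=> lc; have ll := dual_linear l; move: t.
apply: tensor_ext => [||x a].
- by apply: (linear_comp lc); exact: contract2_linear.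
- by apply: (linear_comp ll); exact: contract1_linear.
- by rewrite contract2_tens// contract1_tens// !linZ// [LHS]mulrC.
Qed.

(** Pairing with an arbitrary functional c of g, the bracket of l and m becomes
l (x) m applied to an identity in g[v] (x) g[w]. *)
Lemma contract2_cobracket_dual (l m : dual V) n (s t : 'I_n -> tensor g V) r :
  (forall c : g -> K^o, linear c ->
     \sum_i bracket_contract br c (s i) (t i) = delta (contract1 c r)) ->
  contract2 (cobracket_dual delta_linear l m) r =
  \sum_i br (contract2 l (s i)) (contract2 m (t i)).
Proof.
move=> str; apply/eqP; rewrite -subr_eq0; apply/eqP.
apply: (killing_nondeg cas) => z; have lc := kb.1 z.
rewrite (linB _ _ lc) (contract12 _ _ lc).
apply/eqP; rewrite subr_eq0; apply/eqP.
rewrite cobracket_dualP -str//.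
have ll := dual_linear l; have lm := dual_linear m.
rewrite (lin_sum _ _ _ (tpair_linear ll lm)) (lin_sum _ _ _ lc).
by apply: eq_bigr => i _; rewrite tpair_bracket_contract.
Qed.

(** The components in g((u^-1)) and in g are the contracted Yang-Baxter equation at
infinity and at u = 0. *)
Lemma psi_lie (l m : dual V) : psi (cobracket_dual delta_linear l m) =
  dsum_lie (laurent_lie br) br (psi l) (psi m).
Proof.
have [N cN] := nonneg_coef_bounded.
have B (l' : dual V) : bounded_by N%:Z (psi l').1.
  move=> [n|n]//; rewrite ltz_nat => /cN /= ->.
  exact: lin0 (contract2_linear (dual_linear l')).
congr (_, _).
  apply: val_inj; apply: (@bounded_eq _ _ (N%:Z + N%:Z)).
  - apply: bounded_by_le (B (cobracket_dual delta_linear l m)); lia.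
  - exact: lconv_bounded.
  - move=> k; rewrite [RHS](lconvE br k (B l) (B m)).
    by apply: contract2_cobracket_dual => c lc; exact: Xcoef_bracket.
have := @contract2_cobracket_dual l m 1 (fun=> X_at_0) (fun=> X_at_0) X_at_0.
rewrite big_ord1; apply=> c lc; rewrite big_ord1; exact: X_at_0_bracket.
Qed.

Lemma killing_contract_casimir (l : dual V) n y :
  kil (contract2 l (casimir_coef n)) y = l (mono n y).
Proof.
have [k [e [f [OE _ yf]]]] := casimirP cas; have ll := dual_linear l.
rewrite /casimir_coef OE (lin_sum _ _ _ (hmap_linear _ (mono_linear n)))//.
rewrite (lin_sum _ _ _ (contract2_linear ll)) (bilin_suml kb).
rewrite [in RHS](yf y) (lin_sum _ _ _ (mono_linear n)). 
rewrite dual_sum.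
apply: eq_bigr => i _; rewrite hmap_tens//; last exact: mono_linear.
rewrite contract2_tens// (bilinZl kb) (linZ _ _ (mono_linear n)) (linZ _ _ ll).
by rewrite [LHS]mulrC.
Qed.

(** The coefficients of psi l of degree -n < 0 pair with b_n to l(b_n u^n).  In degree
0 the two components of psi l differ by the contraction of Omega, which gives
l(b_0). *)
Lemma Qform_psi_poly (l : dual V) b : Qform br (psi l) (poly_embedding b) = l b.
Proof.
have [N bN] := vpoly_bounded b; have ll := dual_linear l.
have bN1 k : (N.+1 <= k)%N -> b k = 0 by move=> /ltnW; exact: bN.
rewrite (Qform_poly _ _ bN1) [in RHS](vpoly_sum bN1) dual_sum.
rewrite !big_ord_recl addrAC; congr (_ + _); last first.
  by apply: eq_bigr => i _; exact: killing_contract_casimir.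
have lc := kb.1 (b 0%N).
transitivity (kil (contract2 l (Xcoef 0)) (b 0%N) - kil (contract2 l X_at_0) (b 0%N)).
  by [].
rewrite -(linB _ _ lc) -(linB _ _ (contract2_linear ll)) /X_at_0 subKr.
exact: killing_contract_casimir.
Qed.

Lemma Qform_poly_poly (a b : V) :
  Qform br (poly_embedding a) (poly_embedding b) = 0.
Proof.
have [N bN] := vpoly_bounded b.
have bN1 k : (N.+1 <= k)%N -> b k = 0 by move=> /ltnW; exact: bN.
rewrite (Qform_poly _ _ bN1) big_ord_recl/= peval0 big1 ?addr0 ?subrr//.
by move=> i _; exact: (bilin0l kb).
Qed.

(** The polynomial p with l applied to its second factor. *)
Definition poly_part (l : dual V) : V := contract2 l phat.

Lemma poly_part_coef (l : dual V) n : poly_part l n = contract2 l (nonneg_coef n).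
Proof.
have ll := dual_linear l; rewrite /poly_part /nonneg_coef; move: phat.
apply: tensor_ext => [||a b].
- by apply: (linear_comp (coef_linear n)); exact: contract2_linear.
- by apply: (linear_comp (contract2_linear ll)); exact: hmap_linear.
- by rewrite hmap_tens// !contract2_tens// (linZ _ _ (coef_linear n)).
Qed.

(** What psi would be for X = v Omega / (u - v): no terms of degree >= 0, and
minus the contraction of Omega in the component g. *)
Definition polar_part (l : dual V) := psi l - poly_embedding (poly_part l).

Lemma polar_part_coef (l : dual V) :
  (forall n : nat, (polar_part l).1 n%:Z = 0) /\
  (polar_part l).2 = - contract2 l (casimir_coef 0).
Proof.
have ll := dual_linear l; split=> [n|].
  transitivity (contract2 l (nonneg_coef n) - poly_part l n); first by [].
  by rewrite poly_part_coef subrr.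
transitivity (contract2 l X_at_0 - peval (poly_part l) 0); first by [].
rewrite peval0 poly_part_coef.
rewrite /X_at_0 -[Xcoef 0]/(nonneg_coef 0) (linB _ _ (contract2_linear ll)).
by rewrite addrAC subrr sub0r.
Qed.

(** The skew-symmetry of X, as v/(u - v) + u/(v - u) = -1. *)
Lemma phat_skew : phat + tflip phat = mono2 0 0 Omega.
Proof.
apply: (@eval2_inj _ _ [::]) => u v _ _ uv.
rewrite eval2_mono2 !expr0 mul1r scale1r (linD _ _ (eval2_linear u v)) eval2_tflip.
have vu : v != u by rewrite eq_sym.
have Xuv := XE uv; have Xvu := XE vu; have sk := cybe.2 u v uv.
have lf := @tflip_linear _ g.
move: sk; rewrite Xuv Xvu (linD _ _ lf) (linZ _ _ lf) (casimir_flip cas).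
set A := eval2 u v phat; set B := tflip _ => /eqP.
rewrite -addr_eq0 addrACA -scalerDl.
have -> : v / (u - v) + u / (v - u) = -1.
  have uv0 : u - v != 0 by rewrite subr_eq0.
  rewrite -(opprB u v) invrN mulrN -mulrBl -(opprB u v) mulNr divff//.
by rewrite scaleN1r addrC subr_eq0 => /eqP.
Qed.

Lemma Qform_polar_part (l m : dual V) : Qform br (polar_part l) (polar_part m) =
  - kil (contract2 l (casimir_coef 0)) (contract2 m (casimir_coef 0)).
Proof.
have [l1 l2] := polar_part_coef l; have [m1 m2] := polar_part_coef m.
rewrite /Qform l2 m2 fsbig1 => [|[n|n] _].
- rewrite sub0r -scaleN1r (bilinZl kb) -[X in kil _ X]scaleN1r (bilinZr kb).
  by rewrite !scaleN1r opprK.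
- by rewrite l1; exact: (bilin0l kb).
- by rewrite (_ : - Negz n = n.+1%:Z)// m1; exact: (bilin0r kb).
Qed.

(** Splitting psi into its polar and polynomial parts leaves l(P m) + m(P l), where
P is [poly_part], minus the pairing of the constants in g; this is l (x) m applied
to p + p^21 - Omega. *)
Lemma Qform_psi_psi (l m : dual V) : Qform br (psi l) (psi m) = 0.
Proof.
have ll := dual_linear l; have lm := dual_linear m.
have qb := Qform_bilinear br.
have psiE l' : psi l' = polar_part l' + poly_embedding (poly_part l').
  by rewrite /polar_part subrK.
have polar_poly : Qform br (poly_embedding (poly_part l)) (polar_part m) =
    m (poly_part l).
  rewrite QformC /polar_part (linB _ _ (qb.1 (poly_embedding (poly_part l)))).
  by rewrite Qform_psi_poly Qform_poly_poly subr0.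
have psi_polar : Qform br (psi l) (polar_part m) =
    Qform br (polar_part l) (polar_part m) + m (poly_part l).
  by rewrite {1}[psi l]psiE (bilinDl qb) polar_poly.
have E : Qform br (psi l) (psi m) =
    Qform br (polar_part l) (polar_part m) + (l (poly_part m) + m (poly_part l)).
  rewrite [psi m]psiE (bilinDr qb) psi_polar Qform_psi_poly.
  by rewrite -addrA [_ + l _]addrC.
have K0 : kil (contract2 l (casimir_coef 0)) (contract2 m (casimir_coef 0)) =
    l (poly_part m) + m (poly_part l).
  rewrite killing_contract_casimir.
  have -> : mono 0 (contract2 m (casimir_coef 0)) = contract2 m (mono2 0 0 Omega).
    rewrite /casimir_coef /mono2; move: Omega; apply: tensor_ext => [||x y].
    - apply: (linear_comp (mono_linear 0)).
      apply: (linear_comp (contract2_linear lm)).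
      by apply: hmap_linear => //; exact: mono_linear.
    - apply: (linear_comp (contract2_linear lm)).
      by apply: tmap_linear; exact: mono_linear.
    - rewrite hmap_tens//; last exact: mono_linear.
      rewrite tmap_tens; try exact: mono_linear.
      by rewrite !contract2_tens// (linZ _ _ (mono_linear 0)).
  rewrite -phat_skew (linD _ _ (contract2_linear lm)) (linD _ _ ll).
  by rewrite [X in _ + X]contract2_tpair// tpair_tflip// -contract2_tpair.
by rewrite E Qform_polar_part K0 addNr.
Qed.

Lemma nonneg_subproof (f : vlaurent g) : (fun n : nat => f n%:Z) \in fin_supp.
Proof.
have [N fN] := bounded_natP f; apply/asboolP; exists N.+1 => n Nn.
by apply: fN; rewrite ltz_nat.
Qed.

Definition nonneg_part (f : vlaurent g) : V := VPoly (nonneg_subproof f).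

Lemma Qform_mono s n y : Qform br s (poly_embedding (mono n y)) =
  kil (s.1 (- n%:Z)) y - (if n is 0 then kil s.2 y else 0).
Proof.
rewrite (@Qform_poly _ _ _ n.+1) => [|k nk]; last first.
  by rewrite /=; case: eqP nk => // ->; rewrite ltnn.
rewrite big_ord_recr/= eqxx big1 => [|i _]; last first.
  by rewrite (ltn_eqF (ltn_ord i)); exact: (bilin0r kb).
by rewrite add0r; congr (_ - _); case: n => //= n; exact: (bilin0r kb).
Qed.

(** Testing against y u^n with n > 0 kills the terms of negative degree, and
testing against constants identifies the free term with the component in g. *)
Lemma poly_lagrangian s : (forall b, Qform br s (poly_embedding b) = 0) ->
  s = poly_embedding (nonneg_part s.1).
Proof.
case: s => f x sb.
have fx : f 0 = x.
  apply/eqP; rewrite -subr_eq0; apply/eqP; apply: (killing_nondeg cas) => y.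
  rewrite (linB _ _ (kb.1 y)); exact: etrans (esym (Qform_mono (f, x) 0 y)) (sb _).
congr (_, _); last by rewrite peval0.
apply: val_inj; apply/funext => -[n|n]//=.
apply: (killing_nondeg cas) => y.
have := sb (mono n.+1 y); rewrite Qform_mono subr0; exact.
Qed.

Lemma Qform_functional_linear s :
  linear (fun b : V => Qform br s (poly_embedding b) : K^o).
Proof. exact: linear_comp ((Qform_bilinear br).2 s) (@poly_embedding_linear _ g). Qed.

(** The component in V^* must be Q (s, .), as psi is dual to the embedding of V;
the remainder is then orthogonal to V, hence in V. *)
Definition triple_inv (s : vlaurent g * g) : V * dual V :=
  let l := mk_dual (Qform_functional_linear s) in (nonneg_part (s - psi l).1, l).

Local Notation phi := (triple_map (@poly_embedding K g) psi).

Lemma Qform_triple s t : Qform br (phi s) (phi t) = double_form s t.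
Proof.
have qb := Qform_bilinear br.
rewrite /triple_map (bilinDl qb) !(bilinDr qb) Qform_poly_poly Qform_psi_psi.
rewrite Qform_psi_poly QformC Qform_psi_poly add0r addr0.
by rewrite /double_form addrC.
Qed.

Lemma triple_mapK : cancel phi triple_inv.
Proof.
case=> a l; rewrite /triple_inv.
have -> : mk_dual (Qform_functional_linear (phi (a, l))) = l.
  apply: dual_eq => b; rewrite -[LHS]/(Qform br (phi (a, l)) (poly_embedding b)).
  rewrite -(triple_map1 _ psi_linear b) Qform_triple.
  by rewrite /double_form/= addr0.
congr (_, _); rewrite /triple_map addrK.
exact: vpoly_eq.
Qed.

Lemma triple_invK : cancel triple_inv phi.
Proof.
move=> s; pose l := mk_dual (Qform_functional_linear s).
rewrite -[LHS]/(poly_embedding (nonneg_part (s - psi l).1) + psi l).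
rewrite -poly_lagrangian ?subrK// => b.
rewrite (linB _ _ ((Qform_bilinear br).1 (poly_embedding b))) Qform_psi_poly.
exact: subrr.
Qed.

Lemma dual_separates (a : V) : (forall l : dual V, l a = 0) -> a = 0.
Proof.
move=> la; apply: vpoly_eq => n; apply: (killing_nondeg cas) => z.
exact: (la (mk_dual (linear_comp (kb.1 z) (coef_linear n)))).
Qed.

End Solution.

Theorem theorem3p11 (R : realType) (g : vectType R[i]) (br : lieBracket g)
    (X : R[i] -> R[i] -> tensor g g) :
  is_simple br -> quasi_trigonometric_solution br X ->
  exists delta : vpoly g -> tensor (vpoly g) (vpoly g),
    [/\ unique (is_cobracket_of br X) delta,
        is_lie_bialgebra (poly_lie br) delta
      & exists D : lieBracket (vpoly g * dual (vpoly g))%type,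
          unique (is_classical_double (poly_lie br) delta) D /\
          exists phi : {linear (vpoly g * dual (vpoly g))%type ->
                               (vlaurent g * g)%type},
            [/\ bijective phi,
                forall s t,
                  phi (D s t) = dsum_lie (laurent_lie br) br (phi s) (phi t),
                forall a, phi (a, 0) = poly_embedding a
              & forall s t,
                  Qform br (phi s) (phi t) = double_form s t]].
Proof.
move=> _ [[Omega [p [cas XE]]] cybe].
have [phat phatE] := peval2_polynomial p.
have {}XE u v : u != v -> X u v = (v / (u - v)) *: Omega + eval2 u v phat.
  by move=> uv; rewrite XE// phatE.
have [delta deltaP] := cobracket_exists cas XE.
have [dual_lie double] := manin_triple_classical_double
  (@Qform_invariant _ _ br) (@poly_embedding_linear _ g)
  (psi_linear Omega phat) (poly_embedding_lie br) (psi_lie cas XE cybe deltaP)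
  (Qform_triple cas XE cybe) (triple_mapK cas XE cybe) (triple_invK phat cas)
  (dual_separates cas).
exists delta; split=> //; first exact: (cobracket_unique deltaP).
split=> //; first exact: (delta_linear deltaP).
exact: (delta_cocycle deltaP).
Qed.
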